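(* Let $k$ be an algebraically closed field of characteristic $2$ and let $n$ be a positive integer. Then $\operatorname{ed}(\operatorname{LCA}_{2,n})=\operatorname{ed}_2(\operatorname{LCA}_{2,n})=n+1$.
   Context: For a field $F$ of characteristic $2$, $\alpha\in F$ and $\beta\in F^\times$, $[\alpha,\beta)_{2,F}$ denotes the quaternion $F$-algebra generated by $i,j$ subject to $i^2+i=\alpha$, $j^2=\beta$, $jij^{-1}=i+1$. $\operatorname{LCA}_{2,n}$ is the functor sending each field $F\supseteq k$ to the set of length-$n$ sequences of (isomorphism classes of) quaternion $F$-algebras that can be written in the form $([\alpha,\beta_1)_{2,F},\dots,[\alpha,\beta_n)_{2,F})$ for some $\alpha\in F$ and $\beta_1,\dots,\beta_n\in F^\times$ (the same $\alpha$ in all entries); the maps are given by scalar extension. For a covariant functor $\mathcal F$ from fields containing $k$ to sets and $A\in\mathcal F(F)$, $\operatorname{ed}(A)$ is the minimal $d$ for which there exist a field $E$ with $k\subseteq E\subseteq F$, $\operatorname{tr.deg}(E/k)=d$, and $B\in\mathcal F(E)$ with $B_F=A$. For a prime $p$, $\operatorname{ed}_p(A)$ is the minimum of $\operatorname{ed}(A_L)$ over all finite field extensions $L/F$ of degree prime to $p$. Then $\operatorname{ed}(\mathcal F)$ (resp. $\operatorname{ed}_p(\mathcal F)$) is the supremum of $\operatorname{ed}(A)$ (resp. $\operatorname{ed}_p(A)$) over all fields $F\supseteq k$ and all $A\in\mathcal F(F)$. *)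

(* Defs.v *)
From HB Require Import structures.
From mathcomp Require Import all_boot all_algebra all_field.
From mathcomp Require Import boolp.
From mathcomp Require Import ring.
From mathcomp Require Import mpoly.

Set Implicit Arguments.
Unset Strict Implicit.
Unset Printing Implicit Defensive.

Import GRing.Theory.
Local Open Scope ring_scope.

(* Extended natural numbers; [None] stands for infinity. *)
Definition enat := option nat.

Definition enat_le (x y : enat) : bool :=
  match x, y with
  | _, None => true
  | None, Some _ => false
  | Some m, Some n => (m <= n)%N
  end.

Definition einf (S : enat -> Prop) : enat :=
  match pselect (exists n, `[< S (Some n) >]) with
  | left h => Some (ex_minn h)
  | right _ => None
  end.

Definition esup (S : enat -> Prop) : enat :=
  einf (fun b => forall x, S x -> enat_le x b).

Lemma einfP (S : enat -> Prop) : (exists x, S x) ->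
  S (einf S) /\ forall x, S x -> enat_le (einf S) x.
Proof.
rewrite /einf; case: pselect => [h|noS].
  case: ex_minnP => m /asboolP Sm min_m _; split=> // -[n|] //= Sn.
  exact/min_m/asboolP.
case=> -[n|] Sx; first by case: noS; exists n; apply/asboolP.
by split=> // -[n|] // Sn; case: noS; exists n; apply/asboolP.
Qed.

Lemma esupP (S : enat -> Prop) :
  (forall x, S x -> enat_le x (esup S)) /\
  (forall b, (forall x, S x -> enat_le x b) -> enat_le (esup S) b).
Proof.
have [] // := @einfP (fun b => forall x, S x -> enat_le x b).
by exists None => -[].
Qed.

Record extField (k : fieldType) := ExtField {
  ext_sort :> fieldType;
  ext_mor : {rmorphism k -> ext_sort}
}.
Arguments ext_mor {k} e.

Record extHom (k : fieldType) (E F : extField k) := ExtHom {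
  ext_fun :> {rmorphism E -> F};
  ext_funP : forall x, ext_fun (ext_mor E x) = ext_mor F x
}.

Definition ext_id (k : fieldType) (F : extField k) : extHom F F :=
  @ExtHom k F F (idfun : {rmorphism F -> F}) (fun=> erefl).

Lemma ext_compP (k : fieldType) (E F K : extField k)
    (g : extHom F K) (f : extHom E F) (x : k) :
  (g \o f) (ext_mor E x) = ext_mor K x.
Proof. by rewrite /= !ext_funP. Qed.

Definition ext_comp (k : fieldType) (E F K : extField k)
    (g : extHom F K) (f : extHom E F) : extHom E K :=
  @ExtHom k E K (g \o f : {rmorphism E -> K}) (ext_compP g f).

(* A finite extension of F, viewed as an extension of k through F. *)
Definition finExt (k : fieldType) (F : extField k) (L : fieldExtType F) :
    extField k :=
  @ExtField k L (GRing.in_alg L \o ext_mor F : {rmorphism k -> L}).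

Definition finExt_hom (k : fieldType) (F : extField k) (L : fieldExtType F) :
    extHom F (finExt L) :=
  @ExtHom k F (finExt L) (GRing.in_alg L : {rmorphism F -> L}) (fun=> erefl).

Definition alg_indep (k : fieldType) (E : extField k) (d : nat)
    (v : 'I_d -> E) : Prop :=
  forall p : {mpoly k[d]}, mmap (ext_mor E) v p = 0 -> p = 0.

(* The transcendence degree as the largest size of an algebraically independent
   family; all infinite transcendence degrees are identified. *)
Definition trdeg (k : fieldType) (E : extField k) : enat :=
  esup (fun x => exists d (v : 'I_d -> E), x = Some d /\ alg_indep v).

Record fieldFunctor (k : fieldType) := FieldFunctor {
  fob :> extField k -> Type;
  fmap : forall E F : extField k, extHom E F -> fob E -> fob F;
  fmap_id : forall (F : extField k) (A : fob F), fmap (ext_id F) A = A;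
  fmap_comp : forall (E F K : extField k) (g : extHom F K) (f : extHom E F)
    (A : fob E), fmap (ext_comp g f) A = fmap g (fmap f A)
}.
Arguments fmap {k} _ {E F}.

(* An intermediate field of F/k is given as an extension E of k together with a
   k-embedding of E into F. *)
Definition ed_elt (k : fieldType) (G : fieldFunctor k) (F : extField k)
    (A : G F) : enat :=
  einf (fun x => exists (E : extField k) (j : extHom E F) (B : G E),
    fmap G j B = A /\ x = trdeg E).

Definition edp_elt (p : nat) (k : fieldType) (G : fieldFunctor k)
    (F : extField k) (A : G F) : enat :=
  einf (fun x => exists L : fieldExtType F,
    coprime (\dim {:L}) p /\ x = ed_elt (fmap G (finExt_hom L) A)).

Definition ed (k : fieldType) (G : fieldFunctor k) : enat :=
  esup (fun x => exists (F : extField k) (A : G F), x = ed_elt A).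

Definition edp (p : nat) (k : fieldType) (G : fieldFunctor k) : enat :=
  esup (fun x => exists (F : extField k) (A : G F), x = edp_elt p A).

(* [Quat a b x0 x1 x2 x3] is x0 + x1 i + x2 j + x3 ij in the algebra [a, b),
   multiplied according to i^2 = i + a, j^2 = b, j i = (1 - i) j. With these
   signs the algebra is associative over every field, and in characteristic 2
   the relations read i^2 + i = a and j i = (i + 1) j (lemma quat_rel). *)
Record quat (F : fieldType) (a b : F) : Type :=
  Quat { qc0 : F; qc1 : F; qc2 : F; qc3 : F }.

Section Quaternion.
Variables (F : fieldType) (a b : F).
Implicit Types x y z : quat a b.

Lemma quat_eq x y : qc0 x = qc0 y -> qc1 x = qc1 y ->
  qc2 x = qc2 y -> qc3 x = qc3 y -> x = y.
Proof. by case: x y => [? ? ? ?] [? ? ? ?] /= -> -> -> ->. Qed.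

Definition quat_coords x : F * F * F * F := (qc0 x, qc1 x, qc2 x, qc3 x).
Definition quat_of_coords (t : F * F * F * F) : quat a b :=
  Quat a b t.1.1.1 t.1.1.2 t.1.2 t.2.

Fact quat_coordsK : cancel quat_coords quat_of_coords.
Proof. by case. Qed.

HB.instance Definition _ := Choice.copy (quat a b) (can_type quat_coordsK).

Definition quat_add x y : quat a b :=
  Quat a b (qc0 x + qc0 y) (qc1 x + qc1 y) (qc2 x + qc2 y) (qc3 x + qc3 y).

Definition quat_opp x : quat a b :=
  Quat a b (- qc0 x) (- qc1 x) (- qc2 x) (- qc3 x).

Definition quat_scale (c : F) x : quat a b :=
  Quat a b (c * qc0 x) (c * qc1 x) (c * qc2 x) (c * qc3 x).

Definition quat_mul x y : quat a b :=
  let: Quat x0 x1 x2 x3 := x in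
  let: Quat y0 y1 y2 y3 := y in
  Quat a b
    (x0 * y0 + a * x1 * y1 + b * (x2 * y2 + x2 * y3 - a * x3 * y3))
    (x0 * y1 + x1 * y0 + x1 * y1 + b * (x3 * y2 - x2 * y3))
    (x0 * y2 + x2 * y0 + x2 * y1 + a * (x1 * y3 - x3 * y1))
    (x0 * y3 + x3 * y0 + x1 * y2 + x1 * y3 - x2 * y1).

Fact quat_addA : associative quat_add.
Proof. by move=> x y z; apply: quat_eq => /=; ring. Qed.

Fact quat_addC : commutative quat_add.
Proof. by move=> x y; apply: quat_eq => /=; ring. Qed.

Fact quat_add0 : left_id (Quat a b 0 0 0 0) quat_add.
Proof. by move=> x; apply: quat_eq => /=; ring. Qed.

Fact quat_addN : left_inverse (Quat a b 0 0 0 0) quat_opp quat_add.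
Proof. by move=> x; apply: quat_eq => /=; ring. Qed.

HB.instance Definition _ := GRing.isZmodule.Build (quat a b)
  quat_addA quat_addC quat_add0 quat_addN.

Fact quat_mulA : associative quat_mul.
Proof. by move=> [? ? ? ?] [? ? ? ?] [? ? ? ?]; apply: quat_eq => /=; ring. Qed.

Fact quat_mul1x : left_id (Quat a b 1 0 0 0) quat_mul.
Proof. by move=> [? ? ? ?]; apply: quat_eq => /=; ring. Qed.

Fact quat_mulx1 : right_id (Quat a b 1 0 0 0) quat_mul.
Proof. by move=> [? ? ? ?]; apply: quat_eq => /=; ring. Qed.

Fact quat_mulDl : left_distributive quat_mul +%R.
Proof. by move=> [? ? ? ?] [? ? ? ?] [? ? ? ?]; apply: quat_eq => /=; ring. Qed.

Fact quat_mulDr : right_distributive quat_mul +%R.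
Proof. by move=> [? ? ? ?] [? ? ? ?] [? ? ? ?]; apply: quat_eq => /=; ring. Qed.

Fact quat_1neq0 : Quat a b 1 0 0 0 != 0.
Proof. by apply/eqP => -[] /eqP; rewrite oner_eq0. Qed.

HB.instance Definition _ := GRing.Zmodule_isNzRing.Build (quat a b)
  quat_mulA quat_mul1x quat_mulx1 quat_mulDl quat_mulDr quat_1neq0.

Fact quat_scaleA c d x : quat_scale c (quat_scale d x) = quat_scale (c * d) x.
Proof. by apply: quat_eq => /=; ring. Qed.

Fact quat_scale1 : left_id 1 quat_scale.
Proof. by move=> x; apply: quat_eq => /=; ring. Qed.

Fact quat_scaleDr : right_distributive quat_scale +%R.
Proof. by move=> c x y; apply: quat_eq => /=; ring. Qed.

Fact quat_scaleDl x : {morph quat_scale^~ x : c d / c + d}.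
Proof. by move=> c d; apply: quat_eq => /=; ring. Qed.

HB.instance Definition _ := GRing.Zmodule_isLmodule.Build F (quat a b)
  quat_scaleA quat_scale1 quat_scaleDr quat_scaleDl.

Fact quat_scaleAl (c : F) x y : c *: (x * y) = (c *: x) * y.
Proof. by case: x y => [? ? ? ?] [? ? ? ?]; apply: quat_eq => /=; ring. Qed.

HB.instance Definition _ :=
  GRing.Lmodule_isLalgebra.Build F (quat a b) quat_scaleAl.

Fact quat_scaleAr (c : F) x y : c *: (x * y) = x * (c *: y).
Proof. by case: x y => [? ? ? ?] [? ? ? ?]; apply: quat_eq => /=; ring. Qed.

HB.instance Definition _ :=
  GRing.Lalgebra_isAlgebra.Build F (quat a b) quat_scaleAr.

Definition quat_i : quat a b := Quat a b 0 1 0 0.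
Definition quat_j : quat a b := Quat a b 0 0 1 0.

Lemma quatE x : x = qc0 x *: 1 + qc1 x *: quat_i
                    + qc2 x *: quat_j + qc3 x *: (quat_i * quat_j).
Proof. by apply: quat_eq => /=; ring. Qed.

Lemma quat_gen :
  [/\ quat_i * quat_i = quat_i + a%:A, quat_j * quat_j = b%:A
    & quat_j * quat_i = (1 - quat_i) * quat_j].
Proof. by split; apply: quat_eq => /=; ring. Qed.

Lemma quat_rel : 2%N \in [pchar F] ->
  [/\ quat_i * quat_i + quat_i = a%:A, quat_j * quat_j = b%:A
    & quat_j * quat_i = (quat_i + 1) * quat_j].
Proof.
move=> F2; have [ii jj ji] := quat_gen.
have quatN x : - x = x by apply: quat_eq; exact: (oppr_pchar2 F2).
split=> //; last by rewrite ji quatN addrC.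
by rewrite ii addrAC -{2}[quat_i]quatN subrr add0r.
Qed.

End Quaternion.

Section Lift.
Variables (F : fieldType) (a b : F) (C : algType F) (i j : C).
Hypotheses (ii : i * i = i + a%:A) (jj : j * j = b%:A).
Hypothesis (ji : j * i = (1 - i) * j).

Let H (p q : F) : C := p%:A + q *: i.

Let HD p q r s : H p q + H r s = H (p + r) (q + s).
Proof. by rewrite /H !scalerDl addrACA. Qed.

Let HZ c p q : c *: H p q = H (c * p) (c * q).
Proof. by rewrite /H scalerDr !scalerA. Qed.

Let HM p q r s : H p q * H r s = H (p * r + a * q * s) (p * s + q * r + q * s).
Proof.
have -> : H p q * H r s =
    (p * r)%:A + ((p * s) *: i + (q * r) *: i + (q * s) *: (i * i)).
  rewrite /H mulrDl !mulrDr -!scalerAl -!scalerAr !mul1r !mulr1 !scalerA.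
  by rewrite !addrA.
have -> : a * q * s = q * s * a by ring.
rewrite ii scalerDr scalerA /H !scalerDl -!addrA; congr (_ + _).
by rewrite [RHS]addrC -!addrA.
Qed.

Let HJ p q : j * H p q = H (p + q) (- q) * j.
Proof.
rewrite /H mulrDr -!scalerAr mulr1 ji mulrBl mul1r scalerBr.
by rewrite mulrDl -!scalerAl mul1r scalerDl scaleNr addrA.
Qed.

Definition quat_lift (x : quat a b) : C :=
  H (qc0 x) (qc1 x) + H (qc2 x) (qc3 x) * j.

Fact quat_liftD x y : quat_lift (x + y) = quat_lift x + quat_lift y.
Proof. by rewrite /quat_lift addrACA -mulrDl !HD. Qed.

Fact quat_lift_zmod : zmod_morphism quat_lift.
Proof. by move=> x y; apply: (addIr (quat_lift y)); rewrite -quat_liftD !subrK. Qed.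

Fact quat_liftZ : scalable quat_lift.
Proof. by move=> c x; rewrite /quat_lift scalerDr scalerAl !HZ. Qed.

Fact quat_lift_monoid : monoid_morphism quat_lift.
Proof.
split=> [|[x0 x1 x2 x3] [y0 y1 y2 y3]]; rewrite /quat_lift /=.
  by rewrite /H !scale0r scale1r !addr0 mul0r addr0.
set X := H x0 x1; set Y := H x2 x3.
have -> : (X + Y * j) * (H y0 y1 + H y2 y3 * j) =
    X * H y0 y1 + b *: (Y * H (y2 + y3) (- y3))
    + (X * H y2 y3 + Y * H (y0 + y1) (- y1)) * j.
  have [] := (HJ y0 y1, HJ y2 y3).
  move: X Y (H y0 y1) (H y2 y3) (H _ (- y1)) (H _ (- y3)).
  move=> X Y U V U' V' jU jV.
  rewrite !mulrDl !mulrDr -!mulrA jU (mulrA j V j) jV -(mulrA V' j j) jj.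
  rewrite -!scalerAr mulr1 -!addrA; congr (_ + _).
  by rewrite addrC -!addrA addrCA; congr (_ + _); rewrite addrC.
by rewrite /X /Y !HM HZ !HD; congr (H _ _ + H _ _ * j); ring.
Qed.

HB.instance Definition _ :=
  GRing.isZmodMorphism.Build (quat a b) C quat_lift quat_lift_zmod.
HB.instance Definition _ :=
  GRing.isMonoidMorphism.Build (quat a b) C quat_lift quat_lift_monoid.
HB.instance Definition _ :=
  GRing.isScalable.Build F (quat a b) C *:%R quat_lift quat_liftZ.

(* The presentation of [a, b) by generators and relations. *)
Lemma quat_presentation :
  exists f : {lrmorphism quat a b -> C},
    [/\ f (quat_i a b) = i, f (quat_j a b) = j
      & forall g : {lrmorphism quat a b -> C},
          g (quat_i a b) = i -> g (quat_j a b) = j -> g =1 f].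
Proof.
exists (quat_lift : {lrmorphism quat a b -> C}).
rewrite /= /quat_lift /H /= !scale0r !scale1r !(addr0, add0r) mul0r mul1r addr0.
split=> // g gi gj x.
rewrite [x in LHS]quatE !linearD !linearZ /= rmorphM rmorph1 /= gi gj.
by rewrite /H mulrDl -!scalerAl mul1r -!addrA.
Qed.

End Lift.

(* [phi : A -> B] exhibits B as the scalar extension of the E-algebra A along
   s : E -> F: the universal property of the tensor product of F and A over E. *)
Definition is_scalar_ext (E F : fieldType) (s : {rmorphism E -> F})
    (A : algType E) (B : algType F)
    (phi : {lrmorphism A -> B | s \; *:%R}) : Prop :=
  forall (C : algType F) (psi : {lrmorphism A -> C | s \; *:%R}),
    exists f : {lrmorphism B -> C}, (forall x, f (phi x) = psi x) /\
      forall g : {lrmorphism B -> C}, (forall x, g (phi x) = psi x) -> g =1 f.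

Definition alg_iso (F : fieldType) (A B : algType F) : Prop :=
  exists f : {lrmorphism A -> B}, bijective f.

(* The isomorphism class of an algebra is the collection of the algebras
   isomorphic to it. *)
Definition alg_class (F : fieldType) := algType F -> Prop.

Definition iso_class (F : fieldType) (A : algType F) : alg_class F :=
  fun B => alg_iso A B.

Definition class_ext (E F : fieldType) (s : {rmorphism E -> F})
    (c : alg_class E) : alg_class F :=
  fun B => exists (A : algType E) (phi : {lrmorphism A -> B | s \; *:%R}),
    c A /\ is_scalar_ext phi.

Lemma lrmorphism_of (E F : fieldType) (s : {rmorphism E -> F})
    (A : algType E) (B : algType F) (f : A -> B) :
  zmod_morphism f -> monoid_morphism f -> scalable_for (s \; *:%R) f ->
  exists g : {lrmorphism A -> B | s \; *:%R}, g =1 f.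
Proof.
move=> fZ fM fS.
pose Z := GRing.isZmodMorphism.Build A B f fZ.
pose M := GRing.isMonoidMorphism.Build A B f fM.
pose S := GRing.isScalable.Build E A B (s \; *:%R) f fS.
pose g : {lrmorphism A -> B | s \; *:%R} := HB.pack f Z M S.
by exists g.
Qed.

Lemma lrmorphism_inv (F : fieldType) (A B : algType F)
    (f : {lrmorphism A -> B}) : bijective f ->
  exists g : {lrmorphism B -> A}, cancel f g /\ cancel g f.
Proof.
case=> h fK hK.
have hZ := can2_zmod_morphism fK hK.
have hM := can2_monoid_morphism fK hK.
have hS := can2_scalable fK hK.
pose Z := GRing.isZmodMorphism.Build B A h hZ.
pose M := GRing.isMonoidMorphism.Build B A h hM.
pose S := GRing.isScalable.Build F B A *:%R h hS.
pose g : {lrmorphism B -> A} := HB.pack h Z M S.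
by exists g.
Qed.

Lemma iso_class_eq (F : fieldType) (A B : algType F) :
  alg_iso A B -> iso_class A = iso_class B.
Proof.
case=> f bf; have [g [fK gK]] := lrmorphism_inv bf.
have bg : bijective g by exists f.
apply/funext => C; apply/propext; split=> -[h bh].
  by exists (h \o g : {lrmorphism B -> C}); exact: bij_comp.
by exists (h \o f : {lrmorphism A -> C}); exact: bij_comp.
Qed.

Lemma scalar_ext_quat (E F : fieldType) (s : {rmorphism E -> F}) (a b : E) :
  exists phi : {lrmorphism quat a b -> quat (s a) (s b) | s \; *:%R},
    is_scalar_ext phi /\
    forall x, phi x = Quat _ _ (s (qc0 x)) (s (qc1 x)) (s (qc2 x)) (s (qc3 x)).
Proof.
pose f (x : quat a b) : quat (s a) (s b) :=
  Quat _ _ (s (qc0 x)) (s (qc1 x)) (s (qc2 x)) (s (qc3 x)).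
have fZ : zmod_morphism f.
  by move=> x y; apply: quat_eq; rewrite /= rmorphB.
have fM : monoid_morphism f.
  split=> [|[? ? ? ?] [? ? ? ?]]; apply: quat_eq => /=;
  by rewrite ?rmorph0 ?rmorph1 ?(rmorphB, rmorphD, rmorphM).
have fS : scalable_for (s \; *:%R) f.
  by move=> c x; apply: quat_eq; rewrite /= rmorphM.
have [phi phiE] := lrmorphism_of fZ fM fS.
exists phi; split=> // C psi.
have [ii jj ji] := quat_gen a b.
have psi_ii : psi (quat_i a b) * psi (quat_i a b)
    = psi (quat_i a b) + (s a)%:A.
  by rewrite -rmorphM ii rmorphD /= linearZ /= rmorph1.
have psi_jj : psi (quat_j a b) * psi (quat_j a b) = (s b)%:A.
  by rewrite -rmorphM jj /= linearZ /= rmorph1.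
have psi_ji : psi (quat_j a b) * psi (quat_i a b)
    = (1 - psi (quat_i a b)) * psi (quat_j a b).
  by rewrite -rmorphM ji rmorphM rmorphB rmorph1.
have phi_i : phi (quat_i a b) = quat_i _ _.
  by rewrite phiE; apply: quat_eq; rewrite /= ?rmorph0 ?rmorph1.
have phi_j : phi (quat_j a b) = quat_j _ _.
  by rewrite phiE; apply: quat_eq; rewrite /= ?rmorph0 ?rmorph1.
have [h [hi hj h_uniq]] := quat_presentation psi_ii psi_jj psi_ji.
exists h; split=> [x|g gE]; last by apply: h_uniq; rewrite -?phi_i -?phi_j gE.
rewrite [x]quatE !rmorphD /= !linearZ /=.
have h_i : h (phi (quat_i a b)) = psi (quat_i a b) by rewrite phi_i.
have h_j : h (phi (quat_j a b)) = psi (quat_j a b) by rewrite phi_j.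
rewrite !rmorphM !rmorph1; congr (_ + _ *: _ + _ *: _ + _ *: (_ * _)) => //.
Qed.

Lemma class_ext_quat (E F : fieldType) (s : {rmorphism E -> F}) (a b : E) :
  class_ext s (iso_class (quat a b)) = iso_class (quat (s a) (s b)).
Proof.
have [phi [phi_ext _]] := scalar_ext_quat s a b.
apply/funext => B; apply/propext; split=> [[A [psi [[f bf] psi_ext]]]|[f bf]].
  have [g [fK gK]] := lrmorphism_inv bf.
  have [h [hE _]] := phi_ext B (psi \o f : {lrmorphism _ -> B | s \; *:%R}).
  have [h' [h'E _]] := psi_ext _ (phi \o g : {lrmorphism _ -> _ | s \; *:%R}).
  exists h; exists h' => x.
    have [u [_ u_uniq]] := phi_ext _ phi.
    rewrite -[RHS]/((idfun : {lrmorphism quat (s a) (s b) -> _}) x).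
    rewrite -[LHS]/((h' \o h : {lrmorphism quat (s a) (s b) -> _}) x).
    rewrite !u_uniq //= => y.
    by rewrite hE /= h'E /= fK.
  have [u [_ u_uniq]] := psi_ext _ psi.
  rewrite -[RHS]/((idfun : {lrmorphism B -> _}) x).
  rewrite -[LHS]/((h \o h' : {lrmorphism B -> _}) x).
  rewrite !u_uniq //= => y.
  by rewrite h'E /= hE /= gK.
have [g [fK gK]] := lrmorphism_inv bf.
have [psi psiE] : exists psi : {lrmorphism quat a b -> B | s \; *:%R},
    psi =1 f \o phi.
  apply: lrmorphism_of => [x y|| c x] /=; first by rewrite !rmorphB.
    by split=> [|x y] /=; rewrite ?rmorph1 ?rmorphM.
  by rewrite !linearZ.
exists (quat a b), psi; split.
  by exists (idfun : {lrmorphism quat a b -> _}); exists idfun.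
move=> C chi; have [u [uE u_uniq]] := phi_ext C chi.
exists (u \o g : {lrmorphism B -> C}); split=> [x|v vE x] /=.
  by rewrite psiE /= fK uE.
rewrite -(u_uniq (v \o f : {lrmorphism _ -> C})) /= ?gK // => y.
by rewrite -vE psiE.
Qed.

Definition is_lca (F : fieldType) (n : nat) (A : 'I_n -> alg_class F) : Prop :=
  exists (a : F) (b : 'I_n -> F),
    (forall l, b l != 0) /\ forall l, A l = iso_class (quat a (b l)).

Definition lca_ob (k : fieldType) (n : nat) (F : extField k) : Type :=
  {A : 'I_n -> alg_class F | is_lca A}.

Lemma lca_map_subproof (E F : fieldType) (s : {rmorphism E -> F}) (n : nat)
    (A : 'I_n -> alg_class E) :
  is_lca A -> is_lca (fun l => class_ext s (A l)).
Proof.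
case=> a [b [b_neq0 AE]]; exists (s a), (fun l => s (b l)).
by split=> l; rewrite ?fmorph_eq0 // AE class_ext_quat.
Qed.

Definition lca_map (k : fieldType) (n : nat) (E F : extField k)
    (f : extHom E F) (A : lca_ob n E) : lca_ob n F :=
  exist _ _ (lca_map_subproof f (proj2_sig A)).

Fact lca_map_id (k : fieldType) (n : nat) (F : extField k) (A : lca_ob n F) :
  lca_map (ext_id F) A = A.
Proof.
case: A => A lcaA; apply: eq_exist => /=.
apply/funext => l; have [a [b [_ ->]]] := lcaA.
by rewrite class_ext_quat.
Qed.

Fact lca_map_comp (k : fieldType) (n : nat) (E F K : extField k)
    (g : extHom F K) (f : extHom E F) (A : lca_ob n E) :
  lca_map (ext_comp g f) A = lca_map g (lca_map f A).
Proof.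
case: A => A lcaA; apply: eq_exist => /=.
apply/funext => l; have [a [b [_ ->]]] := lcaA.
by rewrite !class_ext_quat.
Qed.

(* LCA_{2,n}, to be used for k of characteristic 2, see quat_rel. *)
Definition LCA (k : fieldType) (n : nat) : fieldFunctor k :=
  FieldFunctor (@lca_map_id k n) (@lca_map_comp k n).

(* Main.v *)
(* Attach to (a; b_1, ..., b_n) the quadratic Pfister form
     pi = \sum_S b_S (x_S^2 + x_S y_S + a y_S^2),   S a subset of {1, ..., n}.
   By the common slot lemma two presentations of the same sequence of
   quaternion algebras can be linked through slots c_i shared by all pairs
   ([al, be_i), [a, b_i)), and the isotropy of pi survives each step of this
   chain.  If the sequence descends to a field E of transcendence degree at most
   n, then pi is isotropic: either the be_i are 2-dependent, or every element
   of k(be, al) is \sum_S be_S x_S^2 for unique x_S, and isotropy amounts to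
   solving f + C f = al for the Cartier operator C f = x_0 of
   f = \sum_S be_S x_S^2.  C preserves finite-dimensional k-subspaces of
   bounded degree, on which 1 + C is onto because k is algebraically closed.  On
   the other hand pi is anisotropic for independent variables a, b_i, and
   remains so over extensions of odd degree by Springer's theorem.
   The upper bound comes from the field k(a, b_1, ..., b_n). *)
From HB Require Import structures.
Require Import Defs.
From mathcomp Require Import all_boot all_order all_algebra all_field.
From mathcomp Require Import boolp ring zify mpoly.

Set Implicit Arguments.
Unset Strict Implicit.
Unset Printing Implicit Defensive.

Import GRing.Theory.
Local Open Scope ring_scope.

(** * Pfister forms and common slots *)

(** [ring] does not know that 2 = 0. Identities special to characteristic 2 are proved by supplying
    [w], half of the discrepancy. *)
Lemma pchar2_eq (R : nzRingType) (w x y : R) :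
  2%N \in [pchar R] -> x = y + (w + w) -> x = y.
Proof. by move=> R2 ->; rewrite addrr_pchar2 // addr0. Qed.

(** Lets [ring] exploit a hypothesis [l = r]: the goal is certified as its multiple by [c]. *)
Lemma eq_lincomb (R : comNzRingType) (c l r x y : R) :
  l = r -> x - y = c * (l - r) -> x = y.
Proof. by move=> ->; rewrite subrr mulr0 => /eqP; rewrite subr_eq0 => /eqP. Qed.

Section PfisterDefs.
Variable R : comNzRingType.
Implicit Types (a : R) (z : R * R).

Definition qnorm a z : R := z.1 ^+ 2 + z.1 * z.2 + a * z.2 ^+ 2.

Definition setmon n (b : 'I_n -> R) (S : {set 'I_n}) : R := \prod_(i in S) b i.

Definition pfister n a (b : 'I_n -> R) (z : {set 'I_n} -> R * R) : R :=
  \sum_S setmon b S * qnorm a (z S).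

Definition isotropic n a (b : 'I_n -> R) : Prop :=
  exists2 z, pfister a b z = 0 & exists S, z S != 0.

End PfisterDefs.

Lemma pfister_morph (R R' : comNzRingType) (f : {rmorphism R -> R'}) n
    (a : R) (b : 'I_n -> R) (z : {set 'I_n} -> R * R) :
  f (pfister a b z) = pfister (f a) (f \o b) (fun S => (f (z S).1, f (z S).2)).
Proof.
rewrite /pfister rmorph_sum /=; apply: eq_bigr => S _.
by rewrite rmorphM /setmon rmorph_prod /qnorm !(rmorphD, rmorphM, rmorphXn).
Qed.

Lemma pair_neq0 (U V : zmodType) (z : U * V) :
  (z != 0) = (z.1 != 0) || (z.2 != 0).
Proof. by case: z => x y; rewrite -negb_and -xpair_eqE. Qed.

Section PfisterForms.
Variable F : fieldType.
Implicit Types (a t : F) (z : F * F).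

Lemma qnorm0 a : qnorm a 0 = 0.
Proof. by rewrite /qnorm /=; ring. Qed.

Lemma anisotropic_qnorm n a (b : 'I_n -> F) z :
  ~ isotropic a b -> qnorm a z = 0 -> z = 0.
Proof.
move=> anis z0; apply/eqP; apply/negPn/negP => nz; apply: anis.
exists (fun S => if S == set0 then z else 0).
  rewrite /pfister big1 // => S _; case: eqP => _; first by rewrite z0 mulr0.
  by rewrite qnorm0 mulr0.
by exists set0; rewrite eqxx.
Qed.

Definition is_norm a t := exists2 z, t = qnorm a z & t != 0.

(** Multiplication in the quadratic algebra F[t] with t^2 = t - a, whose norm form is [qnorm a]. *)
Definition qnmul a z z' : F * F :=
  (z.1 * z'.1 - a * z.2 * z'.2, z.1 * z'.2 + z.2 * z'.1 + z.2 * z'.2).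

Lemma qnormM a z z' : qnorm a (qnmul a z z') = qnorm a z * qnorm a z'.
Proof. by case: z z' => [x y] [x' y']; rewrite /qnorm /=; ring. Qed.

Lemma qnormZ a c z : qnorm a (c * z.1, c * z.2) = c ^+ 2 * qnorm a z.
Proof. by rewrite /qnorm /=; ring. Qed.

Lemma is_norm1 a : is_norm a 1.
Proof. by exists (1, 0); rewrite ?oner_eq0 // /qnorm /=; ring. Qed.

Lemma is_normM a t t' : is_norm a t -> is_norm a t' -> is_norm a (t * t').
Proof.
move=> [z -> z0] [z' -> z'0]; exists (qnmul a z z'); first by rewrite qnormM.
by rewrite mulf_neq0.
Qed.

Lemma is_normV a t : is_norm a t -> is_norm a t^-1.
Proof.
move=> [z -> z0]; exists ((qnorm a z)^-1 * z.1, (qnorm a z)^-1 * z.2).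
  by rewrite qnormZ expr2 -mulrA mulVf ?mulr1.
by rewrite invr_neq0.
Qed.

Lemma is_norm_setmon n a (t : 'I_n -> F) S :
  (forall i, is_norm a (t i)) -> is_norm a (setmon t S).
Proof.
move=> tN; apply: big_ind => [|x y|i _]; [exact: is_norm1 | exact: is_normM |].
exact: tN.
Qed.

(** Multiplying the product by the conjugate of [z] returns [qnorm a z] times [z']; [h1] and [h2]
    are the two coordinates of this identity. *)
Lemma qnmul_neq0 a z z' : qnorm a z != 0 -> z' != 0 -> qnmul a z z' != 0.
Proof.
case: z z' => [x y] [x' y'] Nz; apply: contra_neq => -[/= e1 e2].
have h1 : qnorm a (x, y) * x' = (x + y) * (x * x' - a * y * y')
    + a * y * (x * y' + y * x' + y * y') by rewrite /qnorm /=; ring.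
have h2 : qnorm a (x, y) * y' = x * (x * y' + y * x' + y * y')
    - y * (x * x' - a * y * y') by rewrite /qnorm /=; ring.
congr pair; apply: (mulfI Nz); rewrite mulr0 ?h1 ?h2 e1 e2; ring.
Qed.

(** Norms are multiplicative, so the factor [setmon t S] is itself a norm and is absorbed into the
    block of [S]. *)
Lemma isotropic_scale n a (b c t : 'I_n -> F) :
  (forall i, is_norm a (t i)) -> (forall i, b i = c i * t i) ->
  isotropic a b -> isotropic a c.
Proof.
move=> tN bE [z z0 [S0 zS0]].
have /boolp.choice[u uE] S : exists w, setmon t S = qnorm a w.
  by have [w] := is_norm_setmon S tN; exists w.
have uN S : qnorm a (u S) != 0 by have [_ _] := is_norm_setmon S tN; rewrite uE.
exists (fun S => qnmul a (u S) (z S)); last by exists S0; rewrite qnmul_neq0.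
rewrite -[RHS]z0; apply: eq_bigr => S _; rewrite qnormM -uE mulrA /setmon.
by rewrite -big_split /=; congr (_ * _); apply: eq_bigr => i _; rewrite bE.
Qed.

Definition toggle (I : finType) (i : I) (S : {set I}) :=
  if i \in S then S :\ i else i |: S.

Lemma toggleK (I : finType) (i : I) : involutive (toggle i).
Proof.
rewrite /toggle => S; have [iS|iS] := boolP (i \in S).
  by rewrite setD11 setD1K.
by rewrite setU11 setU1K.
Qed.

Lemma in_toggle (I : finType) (i : I) S : (i \in toggle i S) = (i \notin S).
Proof. by rewrite /toggle; case: ifPn => iS; rewrite ?setD11 ?setU11. Qed.

Lemma setmonU1 n (b : 'I_n -> F) i (S : {set 'I_n}) :
  i \notin S -> setmon b (i |: S) = b i * setmon b S.
Proof. exact: big_setU1. Qed.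

(** The involution [toggle i] has no fixed points, so equal terms cancel in pairs. *)
Lemma sum_toggle n (i : 'I_n) (G : {set 'I_n} -> F) : 2%N \in [pchar F] ->
  (forall S, G (toggle i S) = G S) -> \sum_S G S = 0.
Proof.
move=> F2 Gt; rewrite (bigID (fun S : {set 'I_n} => i \in S)) /=.
rewrite (reindex_inj (can_inj (toggleK i))) /=.
rewrite -[RHS](addrr_pchar2 F2 (\sum_(S : {set 'I_n} | i \notin S) G S)).
by congr (_ + _); apply: eq_big => S; rewrite ?in_toggle ?Gt.
Qed.

(* The isometry [i |-> i + u + s j] between the norm forms of [a, c) and
   [a + u^2 + u + c s^2, c), where c is the slot of index i0. *)
Lemma isotropic_shift n (i0 : 'I_n) a (c : 'I_n -> F) u s :
  2%N \in [pchar F] ->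
  isotropic a c -> isotropic (a + u ^+ 2 + u + c i0 * s ^+ 2) c.
Proof.
move=> F2 [z z0 [S0 zS0]].
(* Multiplication by j moves the block of [toggle i0 S] to that of [S]. Arriving in a block without
   [i0] uses up j^2 = [c i0], whence the factor [kap S]. *)
pose kap (S : {set 'I_n}) := if i0 \in S then 1 else c i0.
exists (fun S => ((z S).1 + u * (z S).2 + s * kap S * (z (toggle i0 S)).2,
                  (z S).2)); last first.
  have [[S yS]|y0] := pselect (exists S, (z S).2 != 0).
    by exists S; rewrite pair_neq0 yS orbT.
  have {}y0 S : (z S).2 = 0.
    by apply/eqP/negPn/negP => yS; apply: y0; exists S.
  exists S0; move: zS0; rewrite !pair_neq0 /= !y0 !eqxx !orbF.
  by rewrite !mulr0 !addr0.
have kap1 S : setmon c (toggle i0 S) * kap (toggle i0 S) = setmon c S * kap S.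
  rewrite /kap in_toggle /toggle; case: ifPn => iS /=.
    by rewrite -{2}(setD1K iS) setmonU1 ?setD11 //; ring.
  by rewrite setmonU1 //; ring.
have kap2 S : setmon c S * kap S ^+ 2 = c i0 * setmon c (toggle i0 S).
  rewrite /kap /toggle; case: ifPn => iS.
    by rewrite -{1}(setD1K iS) setmonU1 ?setD11 //; ring.
  by rewrite setmonU1 //; ring.
pose y S := (z S).2.
(* Besides the old value there remain a sum together with its toggled copy, and a sum of terms
   invariant under toggling. Both vanish in characteristic 2. *)
transitivity (pfister a c z
    + (\sum_S setmon c S * (c i0 * s ^+ 2) * y S ^+ 2
       + \sum_S setmon c (toggle i0 S) * (c i0 * s ^+ 2) * y (toggle i0 S) ^+ 2)
    + \sum_S setmon c S * kap S * s * y S * y (toggle i0 S)).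
  rewrite /pfister -!big_split /=; apply: eq_bigr => S _.
  have -> : setmon c (toggle i0 S) * (c i0 * s ^+ 2) * y (toggle i0 S) ^+ 2
     = setmon c S * kap S ^+ 2 * s ^+ 2 * y (toggle i0 S) ^+ 2.
    by rewrite kap2; ring.
  move: (setmon c S) (kap S) => m k; rewrite /y.
  case: (z S) (z (toggle i0 S)) => [x1 y1] [x2 y2]; rewrite /qnorm /=.
  apply: (pchar2_eq (w := m * ((u * y1) ^+ 2 + u * y1 ^+ 2 + x1 * u * y1
           + x1 * s * k * y2 + u * y1 * s * k * y2))) => //; ring.
rewrite z0 [X in _ + (_ + X)](reindex_inj (can_inj (toggleK i0))) /=.
under [X in _ + (_ + X)]eq_bigr => S _ do rewrite toggleK.
rewrite addrr_pchar2 // !add0r; apply: (sum_toggle (i := i0) F2) => S.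
by rewrite toggleK kap1; ring.
Qed.
End PfisterForms.

Section CommonSlot.
Variable F : fieldType.
Hypothesis F2 : 2%N \in [pchar F].

(* Both quaternion algebras contain a common element w with w i = (i + 1) w
   for the generators i of either presentation; the two generators i differ by
   an element of the centralizer F + F w. *)
Lemma common_slot (al be a b : F) (f : {lrmorphism quat al be -> quat a b}) :
  injective f -> b != 0 -> (forall z, qnorm a z = 0 -> z = 0) ->
  exists zz : (F * F) * (F * F), exists ys : F * F,
    [/\ be * qnorm al zz.1 = b * qnorm a zz.2, zz.2 != 0
      & al = a + ys.1 ^+ 2 + ys.1 + b * qnorm a zz.2 * ys.2 ^+ 2].
Proof.
move=> f_inj b0 anis.
pose W p q : quat al be := Quat al be 0 0 p q.
(* Every w in the plane spanned by j and ij satisfies w i = (1 - i) w, and a linear form on a plane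
   has a nonzero zero. *)
have [p [q [pq0 W0]]] : exists p q, (p, q) != 0 /\ qc0 (f (W p q)) = 0.
  have WE p q : f (W p q) = p *: f (W 1 0) + q *: f (W 0 1).
    rewrite -!linearZ -rmorphD /=; congr (f _).
    by apply: quat_eq => /=; ring.
  set r := qc0 (f (W 1 0)); set t := qc0 (f (W 0 1)).
  have [t0|t0] := eqVneq t 0.
    exists 0, 1; split; first by rewrite pair_neq0 oner_eq0 orbT.
    by rewrite WE /= -/t t0; ring.
  exists t, (- r); split; first by rewrite pair_neq0 t0.
  by rewrite WE /= -/t -/r; ring.
have ww : f (W p q) * f (W p q) = (be * qnorm al (p, q))%:A.
  have fA c : c%:A = f c%:A by rewrite linearZ /= rmorph1.
  rewrite -rmorphM fA; congr (f _).
  rewrite /qnorm /=; apply: quat_eq => /=.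
  - by apply: (pchar2_eq (w := - (be * al * q ^+ 2))) => //; ring.
  - by ring.
  - by ring.
  - by ring.
have wi : f (W p q) * f (quat_i al be) = (1 - f (quat_i al be)) * f (W p q).
  have -> : 1 - f (quat_i al be) = f (1 - quat_i al be).
    by rewrite rmorphB rmorph1.
  rewrite -!rmorphM; congr (f _).
  by apply: quat_eq => /=; ring.
have ii : f (quat_i al be) * f (quat_i al be) = f (quat_i al be) + al%:A.
  have [e _ _] := quat_gen al be.
  by rewrite -rmorphM e rmorphD /= linearZ /= rmorph1.
have w_neq0 : f (W p q) != 0.
  rewrite -(rmorph0 f) (inj_eq f_inj); apply: contra_neq pq0 => -[-> ->].
  by [].
move: (f (W p q)) (f (quat_i al be)) W0 ww wi ii w_neq0.
move=> [w0 w1 u v] [y0 y1 y2 y3] /= -> ww wi ii w_neq0.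
have w10 : w1 = 0.
  move: (congr1 (@qc1 _ _ _) wi) => /= e.
  apply: (pchar2_eq (w := w1 * (y0 + y1))) => //.
  by apply: (eq_lincomb (c := -1) e); ring.
subst w1; have uv0 : (u, v) != 0.
  by apply: contra_neq w_neq0 => -[-> ->].
have y11 : y1 = 1.
  have : y1 * u = u.
    move: (congr1 (@qc2 _ _ _) wi) => /= e.
    apply: (pchar2_eq (w := - (u * y0))) => //.
    by apply: (eq_lincomb (c := 1) e); ring.
  have : y1 * v = v.
    move: (congr1 (@qc3 _ _ _) wi) => /= e.
    apply: (pchar2_eq (w := - (y0 * v))) => //.
    by apply: (eq_lincomb (c := 1) e); ring.
  move: uv0; rewrite pair_neq0 /= => /orP[] n0 e1 e2; apply: (mulIf n0);
  by rewrite mul1r.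
have y23 : y3 * u = y2 * v.
  apply: (mulfI b0); move: (congr1 (@qc0 _ _ _) wi) => /= e.
  apply: (pchar2_eq (w := - (b * y2 * v) - b * y2 * u + b * a * y3 * v )) => //.
  by apply: (eq_lincomb (c := 1) e); ring.
(* By [y23] the vector (y2, y3) is proportional to (u, v), so the image of i is y0 + i + s w. *)
have [s [y2E y3E]] : exists s, y2 = s * u /\ y3 = s * v.
  move: uv0; rewrite pair_neq0 /= => /orP[] n0.
    by exists (y2 / u); rewrite mulfVK // mulrAC -y23 mulfK.
  by exists (y3 / v); rewrite mulfVK // mulrAC y23 mulfK.
have cE : be * qnorm al (p, q) = b * qnorm a (u, v).
  move: (congr1 (@qc0 _ _ _) ww) => /= e.
  apply: (pchar2_eq (w := - (b * a * v ^+ 2))) => //.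
  by apply: (eq_lincomb (c := -1) e); rewrite /qnorm /=; ring.
exists ((p, q), (u, v)), (y0, s); split=> //=.
move: (congr1 (@qc0 _ _ _) ii) => /= e; rewrite y11 y2E y3E in e.
apply: (pchar2_eq (w := - y0 - b * a * s ^+ 2 * v ^+ 2)) => //.
by apply: (eq_lincomb (c := -1) e); rewrite /qnorm /=; ring.
Qed.

(** Isotropy travels along (al, be), (al, c), (a, c), (a, b), where [c] collects the common slots.
    The outer steps change slots by norms. Since [al] and [a] serve all entries, one shift through
    the single index 0 suffices in the middle. *)
Lemma anisotropic_quat_iso n (n_gt0 : (0 < n)%N) (al a : F) (be b : 'I_n -> F) :
    (forall l, be l != 0) -> (forall l, b l != 0) ->
    (forall l, alg_iso (quat al (be l)) (quat a (b l))) ->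
  ~ isotropic a b -> ~ isotropic al be.
Proof.
move=> be0 b0 iso anis; have a_anis z := @anisotropic_qnorm F n a b z anis.
have /boolp.choice[zz] l : exists zz : (F * F) * (F * F), exists ys : F * F,
    [/\ be l * qnorm al zz.1 = b l * qnorm a zz.2, zz.2 != 0
      & al = a + ys.1 ^+ 2 + ys.1 + b l * qnorm a zz.2 * ys.2 ^+ 2].
  have [f /bij_inj f_inj] := iso l.
  exact: common_slot f_inj (b0 l) a_anis.
move=> /boolp.choice[ys zzP].
have Nz l : qnorm a (zz l).2 != 0.
  by have [_ + _] := zzP l; apply: contra_neq => /a_anis.
have Nz' l : qnorm al (zz l).1 != 0.
  have [e _ _] := zzP l; move: (mulf_neq0 (b0 l) (Nz l)).
  by rewrite -e mulf_eq0 negb_or => /andP[].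
pose c l := b l * qnorm a (zz l).2.
move=> iso_al; apply: anis.
have {iso_al} iso_al : isotropic al c.
  pose t l := (qnorm al (zz l).1)^-1.
  apply: (isotropic_scale (t := t)) iso_al => l.
    by apply: is_normV; exists (zz l).1; rewrite ?Nz'.
  by have [e _ _] := zzP l; rewrite /c -e mulfK.
have {iso_al} : isotropic a c.
  pose i0 := Ordinal n_gt0; have [_ _ e] := zzP i0.
  have -> : a = al + (ys i0).1 ^+ 2 + (ys i0).1 + c i0 * (ys i0).2 ^+ 2.
    rewrite e /c; set y := (ys i0).1; set m := b i0 * _ * _.
    by apply: (pchar2_eq (w := - (y ^+ 2 + y + m))) => //; ring.
  exact: isotropic_shift.
apply: (isotropic_scale (t := fun l => qnorm a (zz l).2)) => l; last by [].
by exists (zz l).2.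
Qed.
End CommonSlot.

(** * Springer's theorem *)

Section Springer.
Variable F : fieldType.

Lemma dvdp_bigcap_gcdp (I : finType) (w : I -> {poly F}) d :
  (d %| \big[@gcdp F/0]_i w i) = [forall i, d %| w i].
Proof.
transitivity (all (fun i => d %| w i) (index_enum I)).
  elim: (index_enum I) => [|i r IH]; first by rewrite big_nil dvdp0.
  by rewrite big_cons dvdp_gcd IH.
apply/allP/forallP => [h i|h i _]; last exact: h.
by apply: h; rewrite mem_index_enum.
Qed.

Lemma coefM_top (p q : {poly F}) m n : (size p <= m.+1)%N -> (size q <= n.+1)%N ->
  (p * q)`_(m + n) = p`_m * q`_n.
Proof.
move=> sp sq; have lt_m : (m < (m + n).+1)%N by rewrite ltnS leq_addr.
rewrite coefM (bigD1 (Ordinal lt_m)) //= addKn big1 ?addr0 // => j.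
rewrite -val_eqE /= neq_ltn => /orP[] ltj.
  rewrite [q`__]nth_default ?mulr0 //; apply: leq_trans sq _.
  by rewrite ltn_subRL ltn_add2r.
by rewrite [p`__]nth_default ?mul0r //; apply: leq_trans sp _.
Qed.

(** With m the largest degree among the coordinates, the coefficient of degree 2m is the value of
    the form at the vector of coefficients of degree m. Anisotropy keeps it nonzero, so the value
    has even degree. *)
Lemma size_pfister_poly n (a : F) (b : 'I_n -> F)
    (z : {set 'I_n} -> {poly F} * {poly F}) :
  ~ isotropic a b -> (exists S, z S != 0) ->
  exists2 m, size (pfister a%:P (polyC \o b) z) = (2 * m).+1%N
    & exists S, (m < size (z S).1)%N || (m < size (z S).2)%N.
Proof.
move=> anis [S0 zS0].
pose M := \max_S maxn (size (z S).1) (size (z S).2).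
have leM S : (size (z S).1 <= M)%N /\ (size (z S).2 <= M)%N.
  by apply/andP; rewrite -geq_max; apply: (bigmax_sup S).
have [S1 S1M] : exists S1, M = maxn (size (z S1).1) (size (z S1).2).
  pose G (S : {set 'I_n}) := maxn (size (z S).1) (size (z S).2).
  exists [arg max_(S > set0 | true) G S].
  exact: (@bigop.bigmax_eq_arg _ set0 xpredT G).
have M_gt0 : (0 < M)%N.
  move: zS0; rewrite pair_neq0 -!size_poly_gt0; have [] := leM S0.
  by move=> h1 h2 /orP[] /leq_trans; apply.
case: M => [|m] in leM S1M M_gt0 * => //; exists m; last first.
  exists S1; move: S1M; rewrite /maxn.
  by case: ifP => _ <-; rewrite ltnSn ?orbT.
have coef_top : (pfister a%:P (polyC \o b) z)`_(m + m)
    = pfister a b (fun S => ((z S).1`_m, (z S).2`_m)).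
  rewrite coef_sum; apply: eq_bigr => S _; have [s1 s2] := leM S.
  rewrite /setmon -(rmorph_prod (@polyC F)) coefCM /qnorm !coefD !coefCM.
  by rewrite !expr2 !coefM_top.
have top_neq0 : (pfister a%:P (polyC \o b) z)`_(m + m) != 0.
  rewrite coef_top; apply/eqP => e; apply: anis; eexists; first exact: e.
  exists S1; move: S1M; rewrite pair_neq0 /= /maxn.
  case: ifP => _ e1; apply/orP; [right|left].
    by rewrite -[m]/(m.+1.-1) e1 -/(lead_coef _) lead_coef_eq0 -size_poly_gt0 -e1.
  by rewrite -[m]/(m.+1.-1) e1 -/(lead_coef _) lead_coef_eq0 -size_poly_gt0 -e1.
apply/eqP; rewrite eqn_leq mul2n -addnn andbC; apply/andP; split.
  by rewrite ltnNge; apply: contra top_neq0 => /leq_sizeP ->.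
have sM (p q : {poly F}) : (size p <= m.+1)%N -> (size q <= m.+1)%N ->
    (size (p * q)%R <= (m + m).+1)%N.
  move=> sp sq; apply: leq_trans (size_polyMleq p q) _.
  lia.
apply: leq_trans (size_sum _ _ _) _; apply/bigmax_leqP => S _.
have [s1 s2] := leM S.
rewrite /setmon -(rmorph_prod (@polyC F)) mul_polyC.
apply: leq_trans (size_scale_leq _ _) _.
rewrite /qnorm !expr2 mul_polyC.
apply: leq_trans (size_polyD _ _) _; rewrite geq_max; apply/andP; split.
  apply: leq_trans (size_polyD _ _) _; rewrite geq_max; apply/andP; split;
  exact: sM.
by apply: leq_trans (size_scale_leq _ _) _; apply: sM.
Qed.

(** [size] is the degree plus one, so even size means odd degree. Degrees add in a product, hence
    one of two factors again has odd degree. *)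
Lemma odd_irreducible_factor (h : {poly F}) : h != 0 -> ~~ odd (size h) ->
  exists q, [/\ irreducible_poly q, q %| h & ~~ odd (size q)].
Proof.
have [m] := ubnP (size h); elim: m h => // m IH h lt_hm h0 odd_h.
have h1 : (1 < size h)%N.
  by move: odd_h h0; rewrite -size_poly_gt0; case: (size h) => [|[]].
have [irr|] := pselect (irreducible_poly h); first by exists h.
move=> nirr.
have [q [q1 qh nqh]] : exists q : {poly F}, [/\ size q != 1%N, q %| h & ~~ (q %= h)].
  apply: contrapT => no_q; apply: nirr; split=> // q q1 qh.
  by apply/negPn/negP => nqh; apply: no_q; exists q.
have [r hE] := dvdpP _ _ qh.
have [q0 r0] : q != 0 /\ r != 0.
  by apply/andP; move: h0; rewrite hE mulf_eq0 negb_or andbC.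
have sE : (size h).+1 = (size r + size q)%N.
  by rewrite hE size_mul // prednK // addn_gt0 size_poly_gt0 r0.
have q_gt1 : (1 < size q)%N.
  by rewrite ltn_neqAle eq_sym q1 size_poly_gt0.
have r_gt1 : (1 < size r)%N.
  rewrite ltn_neqAle size_poly_gt0 r0 andbT eq_sym.
  apply: contra nqh => /eqP r1.
  by rewrite hE -{1}[q]mul1r eqp_mul2r // eqp_sym -size_poly_eq1 r1.
have lt_q : (size q < m)%N.
  move: lt_hm; rewrite ltnS; apply: leq_trans.
  lia.
have lt_r : (size r < m)%N.
  move: lt_hm; rewrite ltnS; apply: leq_trans.
  lia.
have : ~~ odd (size q) || ~~ odd (size r).
  by rewrite -negb_and; lia.
case/orP => odd_s.
  by have [p [ip pq op]] := IH q lt_q q0 odd_s; exists p; rewrite (dvdp_trans pq).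
have [p [ip pr op]] := IH r lt_r r0 odd_s; exists p; split=> //.
by rewrite hE dvdp_mulr.
Qed.

(* Springer's descent: after removing common factors, an isotropic vector
   modulo p of degree < deg p has a value of even degree < 2 deg p, so that
   the cofactor of p has an irreducible factor of smaller odd degree. *)
Lemma springer_descent n (a : F) (b : 'I_n -> F) (p : {poly F})
    (z : {set 'I_n} -> {poly F} * {poly F}) :
  ~ isotropic a b -> irreducible_poly p -> ~~ odd (size p) ->
  p %| pfister a%:P (polyC \o b) z ->
  forall S, (p %| (z S).1) && (p %| (z S).2).
Proof.
move=> anis; have [m] := ubnP (size p); elim: m p z => // m IH p z lt_pm.
move=> irr_p even_p pz.
have [//|/existsNP[S0 /negP zS0]] :=
  pselect (forall S, (p %| (z S).1) && (p %| (z S).2)).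
exfalso.
have p0 : p != 0 by apply: irredp_neq0.
pose w S := ((z S).1 %% p, (z S).2 %% p).
have modE q : q = (q %/ p) * p + q %% p by apply: divp_eq.
have pw : p %| pfister a%:P (polyC \o b) w.
  have -> : pfister a%:P (polyC \o b) w
     = pfister a%:P (polyC \o b) z - (pfister a%:P (polyC \o b) z -
                                      pfister a%:P (polyC \o b) w) by ring.
  rewrite dvdp_sub // /pfister -sumrB.
  apply: (big_ind (fun q => p %| q)) => [|x y hx hy|S _].
  - exact: dvdp0.
  - exact: dvdp_add.
  rewrite -mulrBr dvdp_mull // /w /qnorm /=.
  rewrite {1 2}(modE (z S).1) {1 2}(modE (z S).2).
  set x := _ %/ p; set y := _ %/ p; set r := _ %% p; set s := _ %% p.
  apply/dvdpP; exists (x * (x * p + r *+ 2) + x * (y * p + s) + r * y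
     + a%:P * y * (y * p + s *+ 2)).
  by ring.
have w0 : exists S, w S != 0.
  by exists S0; rewrite pair_neq0 -negb_and; apply: contra zS0.
pose g := \big[@gcdp F/0]_S gcdp (w S).1 (w S).2.
have dvd_g d : (d %| g) = [forall S, (d %| (w S).1) && (d %| (w S).2)].
  by rewrite dvdp_bigcap_gcdp; apply: eq_forallb => S; rewrite dvdp_gcd.
have gw S : (g %| (w S).1) && (g %| (w S).2).
  by move: (dvdpp g); rewrite dvd_g => /forallP.
(* Dividing by the content [g] makes the vector primitive. The irreducible [p] has larger degree
   than [g], hence is coprime to it and still divides the value at [v]. *)
pose v S := ((w S).1 %/ g, (w S).2 %/ g).

have wE S : w S = ((v S).1 * g, (v S).2 * g).
  by have /andP[g1 g2] := gw S; rewrite !divpK.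
have g0 : g != 0.
  have [S wS] := w0; apply: contra wS => /eqP e; have := gw S.
  rewrite e !dvd0p => /andP[/eqP e1 /eqP e2].
  by rewrite [w S]surjective_pairing e1 e2.
have pwv : pfister a%:P (polyC \o b) w = g ^+ 2 * pfister a%:P (polyC \o b) v.
  rewrite /pfister mulr_sumr; apply: eq_bigr => S _; rewrite wE /qnorm /=.
  by move: (setmon _ S) (v S).1 (v S).2 => c x y; ring.
have lt_w S : (size (w S).1 < size p)%N && (size (w S).2 < size p)%N.
  by rewrite !ltn_modp p0.
have lt_g : (size g < size p)%N.
  have [S] := w0; have /andP[g1 g2] := gw S; have /andP[l1 l2] := lt_w S.
  by rewrite pair_neq0 => /orP[] n0; [apply: leq_ltn_trans l1 | apply: leq_ltn_trans l2];
     apply: dvdp_leq.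
have co_pg : coprimep p g.
  have [_ irr] := irr_p; apply/negPn/negP => npg.
  have := irr _ npg (dvdp_gcdl p g) => /andP[_ pg].
  have := dvdp_leq g0 (dvdp_trans pg (dvdp_gcdr p g)).
  by rewrite leqNgt lt_g.
have pv : p %| pfister a%:P (polyC \o b) v.
  by rewrite -(Gauss_dvdpr _ (coprimep_expr 2 co_pg)) -pwv.
have v0 : exists S, v S != 0.
  have [S wS] := w0; exists S; apply: contra_neq wS => vS.
  by rewrite wE vS !mul0r.
have prim d : (forall S, (d %| (v S).1) && (d %| (v S).2)) -> size d = 1%N.
  move=> dv; apply/eqP; rewrite -dvdp1 -(dvdp_mul2r _ _ g0) mul1r dvd_g.
  by apply/forallP => S; rewrite wE !dvdp_mul2r.
have [e sv [S lt_e]] := size_pfister_poly anis v0.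
have {S lt_e} lt_e : (e.+1 < size p)%N.
  have /andP[l1 l2] := lt_w S.
  have le_size (q r : {poly F}) : r != 0 -> (size q <= size (q * r)%R)%N.
    move=> r0; have [->|q0] := eqVneq q 0; first by rewrite size_poly0.
    by rewrite dvdp_leq ?mulf_neq0 // dvdp_mulr.
  by case/orP: lt_e => l; [apply: leq_ltn_trans l1 | apply: leq_ltn_trans l2];
     apply: leq_trans l _; rewrite wE le_size.
have [h hE] := dvdpP _ _ pv.
have h0 : h != 0.
  by apply/eqP => h0; move: sv; rewrite hE h0 mul0r size_poly0.
have sh : (size h + size p = (2 * e).+2)%N.
  rewrite -sv hE size_mul // prednK // addn_gt0 size_poly_gt0 h0 //.
have even_h : ~~ odd (size h).
  move: (congr1 odd sh); rewrite oddD (negPf even_p) addbF => ->.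
  by rewrite /= mul2n odd_double.
have [q [irr_q qh even_q]] := odd_irreducible_factor h0 even_h.
have lt_q : (size q < m)%N.
  apply: leq_ltn_trans (dvdp_leq h0 qh) _.
  by move: sh lt_e lt_pm; clear; move: (size h) (size p) => x y; lia.
have qv : q %| pfister a%:P (polyC \o b) v by rewrite hE dvdp_mulr.
(* By induction [q] divides every coordinate of the primitive vector [v], so it is constant, against
   its odd degree. *)
have s1 := prim q (IH q v lt_q irr_q even_q qv).
by rewrite s1 in even_q.
Qed.

(** Each element of [L] has odd degree, while an inseparable minimal polynomial is a polynomial in
    X^2. So [L] is separable, generated by one element [th]; coordinates lift to polynomials in [th]
    and the descent applies to the minimal polynomial of [th]. *)
Lemma springer n (a : F) (b : 'I_n -> F) (L : fieldExtType F) :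
  2%N \in [pchar F] -> coprime (\dim {:L}) 2 ->
  ~ isotropic a b -> ~ isotropic (in_alg L a) (in_alg L \o b).
Proof.
move=> F2; rewrite coprimen2 => odd_L anis [v v0 [S0 vS0]].
have odd_deg (x : L) : odd (adjoin_degree 1%AS x).
  have := field_dimS (subvf <<1%AS; x>>%AS).
  rewrite dim_Fadjoin dimv1 muln1 => /dvdn_odd dvd.
  exact: dvd.
have sep (x : L) : separable_element 1%AS x.
  apply: contraT => /separablePn_pchar[p p2 [g _ gE]].
  have := congr1 (fun q : {poly L} => (size q).-1) gE.
  have <- : 2%N = p.
    have F2' : 2%N \in [pchar L] by rewrite (pchar_lalg L).
    by move: p2; rewrite (pcharf_eq F2') inE => /eqnP.
  rewrite size_minPoly size_comp_poly size_polyXn /= => e.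
  by have := odd_deg x; rewrite e oddM andbF.
have /eq_adjoin_separable_generator : separable 1%AS {:L}.
  by apply/separableP.
move=> /(_ (sub1v _)); set th := separable_generator _ _ => gen.
have odd_th := odd_deg th.
have /polyOver1P[p pE] := minPolyOver 1%AS th.
have in_algE : in_alg L =1 (GRing.in_alg L : {rmorphism F -> L}) by [].
have irr_p : irreducible_poly p.
  split=> [|q q1 qp].
    rewrite -(size_map_poly (in_alg L)) -pE size_minPoly ltnS.
    by move: odd_th; case: (adjoin_degree _ _).
  have : map_poly (in_alg L) q %| minPoly 1%AS th by rewrite pE dvdp_map.
  have oq : map_poly (in_alg L) q \is a polyOver 1%AS.
    by apply/polyOver1P; exists q.
  move=> /(minPoly_irr oq) /orP[|]; first by rewrite pE eqp_map.
  by rewrite -size_poly_eq1 size_map_poly (negPf q1).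
have even_p : ~~ odd (size p).
  by rewrite -(size_map_poly (in_alg L)) -pE size_minPoly oddS odd_th.
have /boolp.choice[f fE] (x : L) :
    exists q : {poly F}, (map_poly (in_alg L) q).[th] = x.
  have /polyOver1P[q qE] := Fadjoin_polyOver 1%AS th x.
  by exists q; rewrite -qE Fadjoin_poly_eq // -gen memvf.
pose z S := (f (v S).1, f (v S).2).
pose ev q := (map_poly (in_alg L) q).[th].
have evP : ev (pfister a%:P (polyC \o b) z) = 0.
  rewrite -[RHS]v0.
  rewrite /ev (pfister_morph (map_poly (in_alg L) : {rmorphism _ -> _})).
  rewrite -/(horner_eval th _) pfister_morph /pfister.
  apply: eq_bigr => S _; rewrite /= /horner_eval !fE map_polyC hornerC.
  rewrite -surjective_pairing; congr (_ * _); apply: eq_bigr => i _ /=.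
  by rewrite map_polyC /= /horner_eval hornerC.
have pz : p %| pfister a%:P (polyC \o b) z.
  rewrite -(dvdp_map (in_alg L)) -pE minPoly_dvdp //; last exact/rootP.
  by apply/polyOver1P; eexists.
have /andP[p1 p2] := springer_descent anis irr_p even_p pz S0.
have ev0 q : p %| q -> ev q = 0.
  rewrite -(dvdp_map (in_alg L)) -pE => /dvdpP[r rE].
  by rewrite /ev rE hornerM minPolyxx mulr0.
move: vS0; rewrite pair_neq0 -(fE (v S0).1) -(fE (v S0).2) -/(ev _) -/(ev (f _)).
by rewrite (ev0 _ p1) (ev0 _ p2) eqxx.
Qed.
End Springer.

(** * Semilinear equations over an algebraically closed field of characteristic 2 *)

Lemma sqr_sum_pchar2 (R : comNzRingType) (I : Type) (r : seq I) (x : I -> R) :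
  2%N \in [pchar R] -> (\sum_(i <- r) x i) ^+ 2 = \sum_(i <- r) x i ^+ 2.
Proof.
move=> R2; elim: r => [|i r IH]; first by rewrite !big_nil expr0n.
by rewrite !big_cons -IH; apply: (pchar2_eq (w := x i * \sum_(j <- r) x j)) => //;
   ring.
Qed.

Lemma sqr_inj_pchar2 (R : idomainType) (x y : R) :
  2%N \in [pchar R] -> x ^+ 2 = y ^+ 2 -> x = y.
Proof.
move=> R2 exy; apply/eqP; rewrite -subr_eq0 -sqrf_eq0.
by apply/eqP; apply: (pchar2_eq (w := y ^+ 2 - x * y)) => //;
   apply: (eq_lincomb (c := 1) exy); ring.
Qed.

Lemma rect_dependent (K : fieldType) (I J : finType) (A : J -> I -> K) :
  (#|I| < #|J|)%N ->
  exists2 w : J -> K, (exists j, w j != 0) & forall i, \sum_j w j * A j i = 0.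
Proof.
move=> ltIJ; pose M := \matrix_(j < #|J|, i < #|I|) A (enum_val j) (enum_val i).
have : ~~ row_free M.
  by rewrite /row_free neq_ltn (leq_ltn_trans (rank_leq_col M)).
rewrite -kermx_eq0 => /rowV0Pn[u /sub_kermxP uM u0].
exists (fun j => u 0 (enum_rank j)) => [|i].
  have /rV0Pn[j uj] := u0; exists (enum_val j).
  by rewrite enum_valK.
move: (congr1 (fun X : 'rV_#|I| => X 0 (enum_rank i)) uM).
rewrite !mxE => uMi; rewrite -[RHS]uMi.
rewrite (reindex _ (onW_bij _ (enum_val_bij J))) /=.
by apply: eq_bigr => j _; rewrite mxE !enum_rankK enum_valK.
Qed.

Section ClosedChar2.
Variable k : closedFieldType.
Hypothesis k2 : 2%N \in [pchar k].

Lemma sqrt_closed_ex : exists f : k -> k, forall x, f x ^+ 2 = x.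
Proof.
have /boolp.choice[f fE] (x : k) : exists y : k, y ^+ 2 = x.
  have [y yE] := @solve_monicpoly k 2 (fun i => if i == 0%N then x else 0) isT.
  exists y; rewrite yE !big_ord_recl big_ord0 /=; ring.
by exists f.
Qed.

(** The square root, that is, the inverse of Frobenius on [k]. *)
Definition sq : k -> k := projT1 (cid sqrt_closed_ex).

Lemma sqK x : sq x ^+ 2 = x.
Proof. by rewrite /sq; case: cid. Qed.

Lemma sqE x y : y ^+ 2 = x -> sq x = y.
Proof. by move=> yx; apply: sqr_inj_pchar2; rewrite // sqK. Qed.

Lemma sq0 : sq 0 = 0. Proof. by apply: sqE; rewrite expr0n. Qed.

Lemma sqD x y : sq (x + y) = sq x + sq y.
Proof.
apply: sqE; rewrite -{2}[x]sqK -{2}[y]sqK.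
by apply: (pchar2_eq (w := sq x * sq y)) => //; ring.
Qed.

Lemma sqM x y : sq (x * y) = sq x * sq y.
Proof. by apply: sqE; rewrite exprMn !sqK. Qed.

Lemma sq_horner (p : {poly k}) : exists2 q : {poly k}, (size q <= size p)%N
  & forall y, sq p.[y ^+ 2] = q.[y].
Proof.
exists (\poly_(i < size p) sq p`_i) => [|y]; first exact: size_poly.
apply: sqE; rewrite horner_poly sqr_sum_pchar2 // horner_coef.
by apply: eq_bigr => i _; rewrite exprMn sqK -!exprM mulnC.
Qed.

Section Semilinear.
Variables (V : lmodType k) (T : V -> V).
Hypotheses (TD : {morph T : u v / u + v}) (TZ : forall c u, T (c *: u) = sq c *: T u).

Let addvv (u : V) : u + u = 0.
Proof. by rewrite -[u]scale1r -scalerDl addrr_pchar2 // scale0r. Qed.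

Let T0 : T 0 = 0.
Proof. by rewrite -[0](scale0r (0 : V)) TZ sq0 !scale0r. Qed.

Let T_sum (I : Type) (r : seq I) (F : I -> V) :
  T (\sum_(i <- r) F i) = \sum_(i <- r) T (F i).
Proof. exact: (big_morph T TD T0). Qed.

(** For M + 1 iterates, let nu be the coefficient that T puts on the last power T^(M+1) v. Comparing
    coefficients forces a_0 = 1 + c_0 nu and a_(i+1) = sq a_i + c_(i+1) nu, with the closing
    condition sq a_M = nu. For nu = y^(2^M) each a_i is a polynomial in a power of y, and the
    condition becomes a monic equation of degree 2^(M+1) in y. *)
Lemma semilinear_solve_cyclic (v : V) M (c : nat -> k) :
  iter M T v = \sum_(i < M) c i *: iter i T v ->
  exists a : nat -> k,
    let f := \sum_(i < M) a i *: iter i T v in f + T f = v.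
Proof.
case: M => [|M] vM.
  by exists (fun=> 0); rewrite /= !big_ord0 T0 addr0; move: vM; rewrite big_ord0.
pose lam nu := fix lam i := if i is j.+1 then sq (lam j) + c i * nu else 1 + c 0%N * nu.
have [p sp pE] : exists2 p : {poly k}, (size p <= (2 ^ M).+1)%N
    & forall y, lam (y ^+ (2 ^ M)) M = p.[y].
  elim: (M) => [|i [p sp pE]].
    exists (1 + c 0%N *: 'X).
      apply: leq_trans (size_polyD _ _) _; rewrite geq_max size_poly1 /=.
      by apply: leq_trans (size_scale_leq _ _) _; rewrite size_polyX.
    by move=> y; rewrite /= !hornerE expn0 expr1.
  have [q sq_q qE] := sq_horner p.
  exists (q + c i.+1 *: 'X^(2 ^ i.+1)).
    apply: leq_trans (size_polyD _ _) _; rewrite geq_max; apply/andP; split.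
      apply: leq_trans sq_q _; apply: leq_trans sp _.
      by rewrite ltnS leq_exp2l.
    by apply: leq_trans (size_scale_leq _ _) _; rewrite size_polyXn.
  by move=> y; rewrite /= expnS exprM pE qE !hornerE -exprM -expnS.
have [y yE] := @solve_monicpoly k (2 ^ M.+1)%N (fun i => p`_i) (expn_gt0 2 M.+1).
pose nu := y ^+ (2 ^ M).
have lamM : sq (lam nu M) = nu.
  apply: sqE; rewrite pE /nu -exprM -expnSr yE (@horner_coef_wide _ (2 ^ M.+1)%N) //.
  by apply: leq_trans sp _; rewrite ltn_exp2l.
exists (lam nu) => /=; rewrite T_sum.
under [X in _ + X]eq_bigr => i _ do rewrite TZ -iterS.
rewrite [X in _ + X]big_ord_recr /= -iterS lamM vM scaler_sumr.
rewrite big_ord_recl [X in _ + (_ + X)]big_ord_recl /=.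
set A := \sum_(i < M) _; set B := \sum_(i < M) _; set C := \sum_(i < M) _.
have -> : A = B + C.
  rewrite /A /B /C -big_split /=; apply: eq_bigr => i _.
  by rewrite /bump /= add1n scalerDl scalerA [nu * _]mulrC.
rewrite scalerA [nu * _]mulrC scalerDl scale1r.
set D := (_ * _) *: v.
by rewrite [B + (D + C)]addrCA addrACA addvv addr0 -addrA addvv addr0.
Qed.
End Semilinear.
End ClosedChar2.

(** * The Cartier operator on polynomials *)

Section Tsen.
Variables (k : closedFieldType) (n : nat).
Hypothesis k2 : 2%N \in [pchar k].
Local Notation R := {mpoly k[n]}.
Implicit Types (S : {set 'I_n}) (P Q : R).

Let R2 : 2%N \in [pchar R].
Proof. exact: (rmorph_pchar (@mpolyC n k)). Qed.

(* The coordinates of P in the basis of squarefree monomials over the subring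
   of squares. *)
Definition csec S P : R :=
  \sum_(m : 'X_{1..n < msize P}) sq P@_(mesym1 S + m *+ 2) *: 'X_[m].

Lemma mcoeff_csec S P m : (csec S P)@_m = sq P@_(mesym1 S + m *+ 2).
Proof.
have [lt_m|le_m] := ltnP (mdeg m) (msize P).
  exact: (mcoeff_mpoly (fun m => sq P@_(mesym1 S + m *+ 2)) lt_m).
rewrite (memN_msupp_eq0 (m := (mesym1 S + m *+ 2)%MM)); last first.
  apply: msize_mdeg_ge; apply: leq_trans le_m _.
  by rewrite mdegD mdegMn muln2 -addnn addnA leq_addl.
rewrite (sq0 k2) /csec raddf_sum big1 // => m' _ /=.
rewrite mcoeffZ mcoeffX; case: eqP => [e|]; last by rewrite mulr0.
by move: (bmdeg m'); rewrite e ltnNge le_m.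
Qed.

Lemma csecD S P Q : csec S (P + Q) = csec S P + csec S Q.
Proof. by apply/mpolyP => m; rewrite mcoeffD !mcoeff_csec mcoeffD (sqD k2). Qed.

Lemma csecZ S c P : csec S (c *: P) = sq c *: csec S P.
Proof. by apply/mpolyP => m; rewrite mcoeffZ !mcoeff_csec mcoeffZ (sqM k2). Qed.

Lemma csec0 S : csec S 0 = 0.
Proof. by apply/mpolyP => m; rewrite mcoeff_csec !mcoeff0 (sq0 k2). Qed.

Lemma csecX S m : csec S 'X_[m] =
  if S == [set i | odd (m i)] then 'X_[[multinom (m i)./2 | i < n]] else 0.
Proof.
apply/mpolyP => m'; rewrite mcoeff_csec mcoeffX.
have sq1 : sq 1 = 1 :> k by apply: (sqE k2); rewrite expr1n.
have -> : (m == (mesym1 S + m' *+ 2)%MM) =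
    (S == [set i | odd (m i)]) && ([multinom (m i)./2 | i < n] == m').
  apply/eqP/andP => [->|[/eqP-> /eqP<-]].
    split; apply/eqP; [apply/setP => i | apply/mnmP => i].
      by rewrite inE mnmDE mnmE mulmnE muln2 oddD odd_double addbF oddb.
    by rewrite mnmE mnmDE mnmE mulmnE muln2 half_bit_double.
  apply/mnmP => i; rewrite mnmDE mnmE mulmnE mnmE muln2 inE.
  by rewrite odd_double_half.
case: eqP => _ /=; last by rewrite (sq0 k2) mcoeff0.
by rewrite mcoeffX; case: eqP => _; rewrite ?(sq0 k2).
Qed.

Lemma csec_decomp P : P = \sum_S 'X_[mesym1 S] * csec S P ^+ 2.
Proof.
elim/mpolyind: P => [|c m P _ _ IH].
  by rewrite big1 // => S _; rewrite csec0 expr0n mulr0.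
have -> : \sum_S 'X_[mesym1 S] * csec S (c *: 'X_[m] + P) ^+ 2 =
    \sum_S 'X_[mesym1 S] * csec S (c *: 'X_[m]) ^+ 2 +
    \sum_S 'X_[mesym1 S] * csec S P ^+ 2.
  rewrite -big_split /=; apply: eq_bigr => S _; rewrite csecD.
  by apply: (pchar2_eq (w := 'X_[mesym1 S] * csec S (c *: 'X_[m]) * csec S P)) => //;
     ring.
rewrite -IH; congr (_ + _).
rewrite (bigD1 [set i | odd (m i)]) //= big1 => [|S /negPf nS]; last first.
  by rewrite csecZ csecX nS scaler0 expr0n mulr0.
rewrite addr0 csecZ csecX eqxx exprZn sqK -scalerAr mpolyXn -mpolyXD.
congr (_ *: 'X_[_]); apply/mnmP => i.
by rewrite mnmDE mnmE mulmnE mnmE muln2 inE odd_double_half.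
Qed.

Lemma msize_csec S P B : (msize P <= B.*2)%N -> (msize (csec S P) <= B)%N.
Proof.
move=> leP; rewrite msizeE; apply/bigmax_leqP_seq => m.
rewrite mcoeff_msupp mcoeff_csec => nz _.
have : (mesym1 S + m *+ 2)%MM \in msupp P.
  by rewrite mcoeff_msupp; apply: contra_neq nz => ->; rewrite (sq0 k2).
move/msize_mdeg_lt; rewrite mdegD mdegMn muln2 => lt_m.
rewrite -ltn_double; apply: leq_trans leP; apply: leq_ltn_trans lt_m.
by rewrite leq_addl.
Qed.

Variables (E : fieldType) (s : {rmorphism k -> E}) (be : 'I_n -> E).
Local Notation ev := (mmap s be).

Let E2 : 2%N \in [pchar E]. Proof. exact: (rmorph_pchar s). Qed.

Lemma ev_decomp P : ev P = \sum_S setmon be S * ev (csec S P) ^+ 2.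
Proof.
rewrite {1}(csec_decomp P) rmorph_sum /=; apply: eq_bigr => S _.
rewrite rmorphM rmorphXn /= mmapX /setmon; congr (_ * _).
rewrite /mmap1 [RHS]big_mkcond /=; apply: eq_bigr => i _.
by rewrite mnmE; case: (i \in S).
Qed.

(** 2-independence of [be]: its squarefree monomials are linearly independent over the subfield of
    squares. *)
Definition sq_anisotropic := forall x : {set 'I_n} -> E,
  \sum_S setmon be S * x S ^+ 2 = 0 -> forall S, x S = 0.

Hypothesis anis : sq_anisotropic.

(** 2-independence implies algebraic independence: the coordinates [csec S P] are again relations,
    of about half the degree. *)
Lemma ev_inj P : ev P = 0 -> P = 0.
Proof.
have [m] := ubnP (msize P); elim: m P => // m IH P lt_Pm evP.
have [le1|gt1] := leqP (msize P) 1.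
  have PE := msize1_polyC le1; move: evP; rewrite PE mmapC => /eqP.
  by rewrite fmorph_eq0 => /eqP->.
rewrite (csec_decomp P) big1 // => S _; rewrite (IH (csec S P)).
- by rewrite expr0n mulr0.
- have le_h : (msize P <= (uphalf (msize P)).*2)%N.
    by rewrite -{1}[msize P]odd_double_half uphalf_half doubleD leq_add2r; case: odd.
  apply: leq_ltn_trans (msize_csec S le_h) _.
  move: lt_Pm; rewrite ltnS; apply: leq_trans.
  rewrite uphalf_half; move: gt1; move: (msize P) => x; clear; lia.
- by move: S; apply: (anis (x := fun S => ev (csec S P))); rewrite -ev_decomp.
Qed.
End Tsen.

(** [M] is the last index with nonzero weight; the relation is solved for that term. *)
Lemma linear_recurrence (K : fieldType) (V : lmodType K) (u : nat -> V)
    (N : nat) (w : 'I_N -> K) :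
  (exists i, w i != 0) -> \sum_(i < N) w i *: u i = 0 ->
  exists M, exists c : nat -> K, u M = \sum_(i < M) c i *: u i.
Proof.
elim: N w => [|N IH] w [i wi]; first by case: i wi.
rewrite big_ord_recr /=; have [w0|w0] := eqVneq (w ord_max) 0.
  rewrite w0 scale0r addr0; apply: (IH (fun j => w (widen_ord (leqnSn N) j))).
  case: (unliftP ord_max i) => [j|] iE; last by rewrite iE w0 eqxx in wi.
  by exists j; rewrite (_ : widen_ord _ j = i) // iE; apply: ord_inj; rewrite lift_max.
move=> /eqP; rewrite addrC addr_eq0 => /eqP e.
exists N, (fun j => - (w ord_max)^-1 * if insub j is Some i then w i else 0).
apply: (scalerI w0); rewrite e scaler_sumr -sumrN; apply: eq_bigr => j _.
rewrite insubT => [|lt_j]; first by rewrite ltnS ltnW.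
rewrite scalerA mulrA mulrN mulfV // mulN1r scaleNr; congr (- (w _ *: _)).
exact/val_inj.
Qed.

(** * Algebraic elements over k(be), with denominators cleared *)

Section TsenRelation.
Variables (k : closedFieldType) (n : nat).
Hypothesis k2 : 2%N \in [pchar k].
Local Notation R := {mpoly k[n]}.
Variables (E : fieldType) (s : {rmorphism k -> E}) (be : 'I_n -> E) (al : E).
Hypothesis anis : sq_anisotropic be.
Local Notation ev := (mmap s be).

Let E2 : 2%N \in [pchar E]. Proof. exact: (rmorph_pchar s). Qed.

Lemma even_power_expansion m (u : 'I_m -> R) :
  \sum_j ev (u j) * al ^+ (2 * j) =
  \sum_S setmon be S * (\sum_j ev (csec S (u j)) * al ^+ j) ^+ 2.
Proof.
under [RHS]eq_bigr => S _ do rewrite sqr_sum_pchar2 // mulr_sumr.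
rewrite exchange_big /=; apply: eq_bigr => j _.
rewrite (ev_decomp k2) mulr_suml; apply: eq_bigr => S _.
by rewrite exprMn -exprM [(j * 2)%N]mulnC -[LHS]mulrA.
Qed.

Definition rel_eval (p : {poly R}) : E := (map_poly ev p).[al].

Lemma rel_eval_wide m (p : {poly R}) : (size p <= m)%N ->
  rel_eval p = \sum_(i < m) ev p`_i * al ^+ i.
Proof.
move=> sp; rewrite /rel_eval (@horner_coef_wide _ m).
  by apply: eq_bigr => i _; rewrite coef_map.
by apply: leq_trans (size_poly _ _) sp.
Qed.

(** A relation of least degree stands in for the minimal polynomial of [al] over k(be), without
    passing to fractions. *)
Lemma minimal_relation (r : {poly R}) : r != 0 -> rel_eval r = 0 ->
  exists r0, [/\ r0 != 0, rel_eval r0 = 0 &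
    forall p : {poly R}, (size p < size r0)%N -> rel_eval p = 0 -> p = 0].
Proof.
have [m] := ubnP (size r); elim: m r => // m IH r lt_rm r0 er.
have [[p [lt_pr ep p0]]|no] :=
    pselect (exists p : {poly R}, [/\ (size p < size r)%N, rel_eval p = 0 & p != 0]).
  by apply: (IH p) => //; apply: leq_trans lt_pr lt_rm.
exists r; split=> // p lt_p ep; apply/eqP/negPn/negP => p0.
by apply: no; exists p.
Qed.

Variables (m : nat) (r : {poly R}).
Hypotheses (r_neq0 : r != 0) (er : rel_eval r = 0) (sr : size r = m.+1).
Hypothesis min_r : forall p : {poly R}, (size p <= m)%N -> rel_eval p = 0 -> p = 0.

Lemma powers_independent (u : 'I_m -> R) :
  \sum_i ev (u i) * al ^+ i = 0 -> forall i, u i = 0.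
Proof.
case: m min_r u => [|m'] minr u u0 i; first by case: i.
pose p := \poly_(j < m'.+1) u (inord j).
have sp : (size p <= m'.+1)%N by exact: size_poly.
have p0 : p = 0.
  apply: minr => //; rewrite (rel_eval_wide sp) -[RHS]u0.
  by apply: eq_bigr => j _; rewrite coef_poly ltn_ord inord_val.
have := congr1 (fun q : {poly R} => q`_i) p0.
by rewrite coef0 coef_poly ltn_ord inord_val.
Qed.

Lemma even_powers_independent (u : 'I_m -> R) :
  \sum_j ev (u j) * al ^+ (2 * j) = 0 -> forall j, u j = 0.
Proof.
rewrite even_power_expansion => /anis h j.
rewrite (csec_decomp k2 (u j)) big1 // => S _.
by rewrite (powers_independent (h S) j) expr0n mulr0.
Qed.

(** Pseudo-division by [r]: the multiplier is a power of its leading coefficient. *)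
Lemma relation_reduce (p : {poly R}) : exists2 c : R, c != 0 &
  exists h : 'I_m -> R, ev c * rel_eval p = \sum_i ev (h i) * al ^+ i.
Proof.
exists (lead_coef r ^+ scalp p r); first by rewrite expf_neq0 ?lead_coef_eq0.
exists (fun i => (p %% r)%R`_i).
have sm : (size (p %% r)%R <= m)%N by rewrite -ltnS -sr ltn_modp.
rewrite -(rel_eval_wide sm).
have e := Pdiv.Idomain.divp_eq p r.
move: (congr1 rel_eval e); rewrite /rel_eval -mul_polyC !rmorphD !rmorphM /=.
by rewrite map_polyC !hornerE -/(rel_eval r) er mulr0 add0r.
Qed.

(* Denominators cleared: the even powers of al span k(be)(al) over k(be). *)
Lemma even_powers_span :
  exists D : R, exists g : 'I_m -> 'I_m -> R, exists h : 'I_m -> R,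
  [/\ D != 0, forall i : 'I_m, ev D * al ^+ i = \sum_j ev (g i j) * al ^+ (2 * j)
    & ev D * al = \sum_i ev (h i) * al ^+ i].
Proof.
have /boolp.choice[c cP] (j : 'I_m) : exists c : R, c != 0 /\
    exists h : 'I_m -> R, ev c * al ^+ (2 * j) = \sum_i ev (h i) * al ^+ i.
  have [c c0 [h hE]] := relation_reduce 'X^(2 * j); exists c; split=> //; exists h.
  by rewrite -hE /rel_eval map_polyXn hornerXn.
have /boolp.choice[H HE] (j : 'I_m) :
    exists h : 'I_m -> R, ev (c j) * al ^+ (2 * j) = \sum_i ev (h i) * al ^+ i.
  by have [_] := cP j.
have [c' c'0 [h' h'E]] := relation_reduce 'X.
(* [M] expresses multiples of the even powers in the ordinary powers. Independence of the even
   powers makes its determinant nonzero, and the adjugate inverts it over the polynomial ring. *)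
pose M := \matrix_(j, i) H j i.
have detM : \det M != 0.
  apply/det0P => -[v v0 vM]; have /rV0Pn[j vj] := v0.
  have /(_ j)/eqP : forall j, v 0 j * c j = 0.
    apply: even_powers_independent.
    transitivity (\sum_i ev ((v *m M) 0 i) * al ^+ i); last first.
      by rewrite vM big1 // => i _; rewrite mxE mmap0 mul0r.
    under eq_bigr => i _ do rewrite rmorphM -mulrA HE mulr_sumr.
    rewrite exchange_big; apply: eq_bigr => i _ /=.
    rewrite mxE rmorph_sum mulr_suml; apply: eq_bigr => j' _ /=.
    by rewrite mxE rmorphM mulrA.
  by rewrite mulf_eq0 (negPf vj) /=; have [/negPf->] := cP j.
exists (\det M * c'), (fun i j => c' * (\adj M i j * c j)), (fun i => \det M * h' i).
split; first by rewrite mulf_neq0.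
  move=> i; rewrite [\det M * c']mulrC rmorphM /=.
  under eq_bigr => j _ do rewrite !rmorphM -!mulrA HE /=.
  rewrite -mulr_sumr -mulrA; congr (_ * _).
  under eq_bigr => j _ do rewrite mulr_sumr.
  rewrite exchange_big /= (bigD1 i) //= [X in _ + X]big1 => [|i' ni].
    rewrite addr0.
    have := mul_adj_mx M => /matrixP/(_ i i); rewrite 2!mxE eqxx mulr1n => <-.
    rewrite rmorph_sum mulr_suml; apply: eq_bigr => j _ /=.
    by rewrite rmorphM [M _ _]mxE mulrA.
  have e : \sum_j \adj M i j * M j i' = 0.
    by have := mul_adj_mx M => /matrixP/(_ i i'); rewrite !mxE eq_sym (negPf ni).
  transitivity (ev (\sum_j \adj M i j * M j i') * al ^+ i'); last first.
    by rewrite e mmap0 mul0r.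
  rewrite rmorph_sum mulr_suml; apply: eq_bigr => j _ /=.
  by rewrite rmorphM [M _ _]mxE mulrA.
rewrite rmorphM -mulrA -[al in LHS](_ : rel_eval 'X = al) ?h'E; last first.
  by rewrite /rel_eval map_polyX hornerX.
by rewrite mulr_sumr; apply: eq_bigr => i _; rewrite rmorphM mulrA.
Qed.
End TsenRelation.

(** * Solving the Cartier equation on numerators *)

Section TsenSolve.
Variables (k : closedFieldType) (n m : nat).
Hypothesis k2 : 2%N \in [pchar k].
Local Notation R := {mpoly k[n]}.
Variable g : 'I_m -> 'I_m -> R.
Local Notation V := {ffun 'I_m -> R}.

Definition rowmul (h : V) (j : 'I_m) : R := \sum_i h i * g i j.

(** With [g] and [D] from [even_powers_span], [rowmul h] lists the coefficients of D h in the even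
    powers of [al]. As h / D = D h / D^2, [cartier] is the operator C on numerators over [D]. *)
Definition cartier (h : V) : V := [ffun j => csec set0 (rowmul h j)].

Lemma cartierD : {morph cartier : u v / u + v}.
Proof.
move=> u v; apply/ffunP => j; rewrite !ffunE -csecD //; congr (csec _ _).
by rewrite /rowmul -big_split; apply: eq_bigr => i _; rewrite ffunE mulrDl.
Qed.

Lemma cartierZ c u : cartier (c *: u) = sq c *: cartier u.
Proof.
apply/ffunP => j; rewrite !ffunE -csecZ //; congr (csec _ _).
by rewrite /rowmul scaler_sumr; apply: eq_bigr => i _; rewrite ffunE scalerAl.
Qed.

(* The iterates of h under the Cartier operator have bounded degree, hence
   span a finite-dimensional space. *)
Lemma cartier_solve (h : V) : exists f : V, f + cartier f = h.
Proof.
(* Multiplying by [g] at most doubles the bound [B], and [csec] halves it again. *)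
pose B := maxn (\max_i msize (h i)) (\max_i \max_j msize (g i j)).
have bd t i : (msize (iter t cartier h i) <= B)%N.
  elim: t i => [|t IH] i.
    by rewrite leq_max (leq_bigmax (F := fun i => msize (h i))).
  rewrite iterS ffunE; apply: (msize_csec k2).
  apply: leq_trans (msize_sum _ _ _) _; apply/bigmax_leqP => l _.
  have [->|u0] := eqVneq (iter t cartier h l) 0; first by rewrite mul0r mmeasure0.
  have [->|g0] := eqVneq (g l i) 0; first by rewrite mulr0 mmeasure0.
  rewrite msizeM //; apply: leq_trans (leq_pred _) _.
  rewrite -addnn; apply: leq_add; first exact: IH.
  rewrite leq_max; apply/orP; right.
  apply: leq_trans (leq_bigmax (F := fun i => \max_j msize (g i j)) l).
  exact: (leq_bigmax (F := fun j => msize (g l j))).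
pose I : finType := ('I_m * 'X_{1..n < B})%type.
have [|w w0 wP] := @rect_dependent k I 'I_#|I|.+1
    (fun t i => (iter t cartier h i.1)@_i.2); first by rewrite card_ord.
have [|M [c vM]] := @linear_recurrence k V (fun t => iter t cartier h) _ w w0.
  apply/ffunP => i; rewrite sum_ffunE ffunE; apply/mpolyP => mu.
  rewrite mcoeff0 raddf_sum /=.
  have [lt_mu|le_mu] := ltnP (mdeg mu) B.
    rewrite -[RHS](wP (i, BMultinom lt_mu)).
    by apply: eq_bigr => t _; rewrite ffunE mcoeffZ.
  rewrite big1 // => t _; rewrite ffunE mcoeffZ [_@_mu]memN_msupp_eq0 ?mulr0 //.
  by apply: msize_mdeg_ge; apply: leq_trans le_mu.
have [a aE] := semilinear_solve_cyclic k2 cartierD cartierZ vM.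
by eexists; apply: aE.
Qed.
End TsenSolve.

Lemma tsen_isotropic (k : closedFieldType) (n : nat) (E : fieldType)
    (s : {rmorphism k -> E}) (be : 'I_n -> E) (al : E) (r : {poly {mpoly k[n]}}) :
  2%N \in [pchar k] -> r != 0 -> (map_poly (mmap s be) r).[al] = 0 ->
  isotropic al be.
Proof.
move=> k2 r0 er; apply: contrapT => niso.
have E2 : 2%N \in [pchar E] by exact: (rmorph_pchar s).
have anis : sq_anisotropic be.
  move=> x x0 S; apply/eqP/negPn/negP => xS; apply: niso.
  exists (fun S => (x S, 0)); last by exists S; rewrite pair_neq0 xS.
  rewrite -[RHS]x0; apply: eq_bigr => S' _; congr (_ * _).
  by rewrite /qnorm /=; ring.
have [{er}r1 [{r0}r0 er min_r]] := minimal_relation r0 er.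
have [m sr] : exists m, size r1 = m.+1.
  by exists (size r1).-1; rewrite prednK // size_poly_gt0.
rewrite sr in min_r.
have [D [g [h [D0 gE hE]]]] := even_powers_span k2 anis r0 er sr min_r.
have [f fE] := cartier_solve k2 g (finfun h).
pose ev := mmap s be.
have evD0 : ev D != 0.
  by apply: contra_neq D0 => /(ev_inj k2 anis).
pose pw (u : {ffun 'I_m -> {mpoly k[n]}}) := \sum_i ev (u i) * al ^+ i.
have pwD u v : pw (u + v) = pw u + pw v.
  rewrite /pw -big_split /=; apply: eq_bigr => i _.
  by rewrite ffunE /ev mmapD mulrDl.
pose x S := (\sum_j ev (csec S (rowmul g f j)) * al ^+ j) / ev D.
have x_0 : x set0 = pw (cartier g f) / ev D.
  by congr (_ / _); apply: eq_bigr => j _; rewrite ffunE.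
have xsum : \sum_S setmon be S * x S ^+ 2 = pw f / ev D.
  transitivity ((pw f * ev D) / ev D ^+ 2); last first.
    by rewrite expr2 invfM mulrA mulfK.
  transitivity ((\sum_j ev (rowmul g f j) * al ^+ (2 * j)) / ev D ^+ 2).
    rewrite (even_power_expansion k2) mulr_suml; apply: eq_bigr => S _.
    by rewrite /x expr_div_n mulrA.
  congr (_ / _); rewrite /pw mulr_suml.
  under [RHS]eq_bigr => i _ do rewrite mulrAC -mulrA gE mulr_sumr.
  rewrite exchange_big /=; apply: eq_bigr => j _.
  rewrite /rowmul /ev rmorph_sum mulr_suml; apply: eq_bigr => i _ /=.
  by rewrite rmorphM mulrA.
have alE : pw f / ev D + x set0 = al.
  rewrite x_0 -mulrDl -pwD fE; apply: (mulIf evD0); rewrite mulfVK //.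
  by rewrite mulrC hE; apply: eq_bigr => i _; rewrite ffunE.
(* With y_S = 1 only for the empty set, the form takes the value f + C f + al, which is zero by the
   choice of f. *)
apply: niso; exists (fun S => (x S, (S == set0)%:R)); last first.
  by exists set0; rewrite pair_neq0 /= eqxx oner_eq0 orbT.
rewrite /pfister (eq_bigr (fun S => setmon be S * x S ^+ 2 +
    setmon be S * (x S + al) * (S == set0)%:R)); last first.
  move=> S _; rewrite /qnorm /=; case: eqP => _; rewrite ?(mulr1n, mulr0n); ring.
rewrite big_split /= xsum (bigD1 set0) //= big1 ?addr0 => [|S /negPf->]; last first.
  by rewrite mulr0.
rewrite /setmon big_set0 eqxx mul1r mulr1 addrA alE.
exact: addrr_pchar2.
Qed.

(** * Splitting off the last variable *)

Section LastVariable.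
Variables (n : nat) (K : fieldType) (E : fieldType) (s : {rmorphism K -> E}).

Let rest (m : 'X_{1..n.+1}) : 'X_{1..n} :=
  [multinom m (widen_ord (leqnSn n) i) | i < n].

Lemma muni_inj (p : {mpoly K[n.+1]}) : muni p = 0 -> p = 0.
Proof.
move=> p0; apply/mpolyP => m; rewrite mcoeff0.
have := congr1 (fun q : {poly {mpoly K[n]}} => (q`_(m ord_max))@_(rest m)) p0.
rewrite coef0 mcoeff0 => <-; rewrite muniE coef_sum raddf_sum /=.
rewrite {1}[p]mpolyE raddf_sum; apply: eq_bigr => m' _ /=.
rewrite coefZ coefXn mulr_natr mcoeffMn !mcoeffZ !mcoeffX -/(rest m').
have -> : (m' == m) = (m ord_max == m' ord_max) && (rest m' == rest m).
  apply/eqP/andP => [->|[/eqP e1 /eqP/mnmP e2]]; first by rewrite !eqxx.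
  apply/mnmP => i; case: (unliftP ord_max i) => [j ->|-> //].
  have := e2 j; rewrite !mnmE; congr (m' _ = m _); apply: ord_inj;
  by rewrite lift_max.
by case: eqP; case: eqP => _ _; rewrite /= ?(mulr1, mulr0, mulr1n, mulr0n).
Qed.

Lemma mmap_muni (v : 'I_n.+1 -> E) (p : {mpoly K[n.+1]}) :
  (map_poly (mmap s (v \o widen_ord (leqnSn n))) (muni p)).[v ord_max] = mmap s v p.
Proof.
rewrite muniE rmorph_sum horner_sum; apply: eq_bigr => m _ /=.
rewrite map_polyZ map_polyXn hornerZ hornerXn /= mmapZ mmapX -mulrA.
congr (_ * _); rewrite /mmap1 big_ord_recr /=; congr (_ * _).
by apply: eq_bigr => i _; rewrite mnmE.
Qed.
End LastVariable.

(** * Generic Pfister forms *)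

Section GenericPoint.
Variables (k : fieldType) (n : nat).
Local Notation R := {mpoly k[n.+1]}.
Local Notation last := (@ord_max n).
Local Notation wid := (widen_ord (leqnSn n)).

Definition gen_slot : R := 'X_last.
Definition gen_slots (i : 'I_n) : R := 'X_(wid i).

Let bexp (S : {set 'I_n}) : 'X_{1..n.+1} := (\sum_(i in S) U_(wid i))%MM.

Let setmon_gen S : setmon gen_slots S = 'X_[bexp S].
Proof. by rewrite /setmon /bexp mprodXE. Qed.

Let bexp_wid S i : bexp S (wid i) = (i \in S) :> nat.
Proof.
rewrite /bexp mnm_sumE (eq_bigr (fun j : 'I_n => (j == i) : nat)); last first.
  by move=> j _; rewrite mnm1E -val_eqE.
have [iS|iS] := boolP (i \in S).
  rewrite (bigD1 i) //= eqxx big1 ?addn0 // => j /andP[_].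
  by case: eqP.
by rewrite big1 // => j jS; case: eqP => // ji; rewrite -ji jS in iS.
Qed.

Let bexp_last S : bexp S last = 0%N.
Proof.
rewrite /bexp mnm_sumE big1 // => i _; rewrite mnm1E -val_eqE /=.
by rewrite (ltn_eqF (ltn_ord i)).
Qed.

(* The leading monomials of the terms b_S x_S^2 and b_S a y_S^2 have pairwise
   distinct parities, and each cross term b_S x_S y_S lies strictly below one
   of them. *)
Lemma generic_anisotropic : ~ isotropic gen_slot gen_slots.
Proof.
move=> [z z0 [S0 zS0]].
pose w (t : {set 'I_n} * bool) := if t.2 then (z t.1).2 else (z t.1).1.
pose texp (t : {set 'I_n} * bool) : 'X_{1..n.+1} :=
  (bexp t.1 + U_(last) *+ t.2 + mlead (w t) *+ 2)%MM.
pose term (t : {set 'I_n} * bool) := 'X_[bexp t.1 + U_(last) *+ t.2] * w t ^+ 2.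
have mlead_term t : w t != 0 -> mlead (term t) = texp t.
  move=> wt; rewrite mleadM ?expf_neq0 ?mleadXm ?mleadX //.
  by rewrite -msupp_eq0 msuppX.
have texp_inj : injective texp.
  move=> [S e] [S' e'] /mnmP eq_t.
  have odd_t t i : odd (texp t i) =
      odd ((bexp t.1 + U_(last) *+ t.2)%MM i).
    by rewrite {1}/texp mnmDE oddD mulmnE oddM /= andbF addbF.
  congr pair.
    apply/setP => i; have := congr1 odd (eq_t (wid i)).
    rewrite !odd_t !mnmDE !mulmnE !mnm1E /= -!val_eqE /=.
    by rewrite (gtn_eqF (ltn_ord i)) !mul0n !addn0 !bexp_wid !oddb.
  have := congr1 odd (eq_t last).
  by rewrite !odd_t !mnmDE !mulmnE !mnm1E eqxx !mul1n !bexp_last !oddb.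
have [t0 wt0] : exists t, w t != 0.
  move: zS0; rewrite pair_neq0 => /orP[h|h].
    by exists (S0, false).
  by exists (S0, true).
have [t1 wt1 max_t1] : exists2 t, w t != 0 &
    forall t', w t' != 0 -> (texp t' <= texp t)%O.
  by case: (@Order.TotalTheory.arg_maxP _ _ _ t0 (fun t => w t != 0) texp wt0)
    => t1 wt1 max_t1; exists t1.
have term_coef (t : {set 'I_n} * bool) : t != t1 -> (term t)@_(texp t1) = 0.
  move=> nt; have [wt|wt] := eqVneq (w t) 0.
    by rewrite /term wt expr0n mulr0 mcoeff0.
  apply: mcoeff_gt_mlead; rewrite mlead_term // Order.POrderTheory.lt_neqAle.
  by rewrite max_t1 // (inj_eq texp_inj) nt.
have cross S : ('X_[bexp S] * ((z S).1 * (z S).2))@_(texp t1) = 0.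
  have [->|x0] := eqVneq (z S).1 0; first by rewrite mul0r mulr0 mcoeff0.
  have [->|y0] := eqVneq (z S).2 0; first by rewrite !mulr0 mcoeff0.
  have X0 : 'X_[bexp S] != 0 :> R by rewrite -msupp_eq0 msuppX.
  apply: mcoeff_gt_mlead; rewrite !mleadM ?mulf_neq0 // mleadXm.
  (* If x does not dominate y, the term a y^2 wins by the extra degree of a; otherwise x^2 beats x y
     strictly. *)
  have [le_xy|lt_yx] := Order.TotalTheory.leP (mlead (z S).1) (mlead (z S).2).
    apply: Order.POrderTheory.lt_le_trans (max_t1 (S, true) y0).
    apply: lt_mdeg_ltmc; rewrite /texp /w /= !mdegD !mdegMn mdeg1.
    move: (lemc_mdeg le_xy) (mdeg (bexp S)); rewrite /= muln1.
    by move: (mdeg _) (mdeg _) => p q; clear; lia.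
  apply: Order.POrderTheory.lt_le_trans (max_t1 (S, false) x0).
  rewrite /texp /w /= mulm0n addm0 ltmc_add2r mulmS mulm1n ltmc_add2r.
  exact: lt_yx.
have := congr1 (mcoeff (texp t1)) z0; rewrite mcoeff0.
suff -> : pfister gen_slot gen_slots z =
    \sum_t term t + \sum_S 'X_[bexp S] * ((z S).1 * (z S).2).
  rewrite mcoeffD !raddf_sum /= [X in _ + X]big1 => [|S _]; last exact: cross.
  rewrite addr0 (bigD1 t1) //= [X in _ + X]big1 => [|t /term_coef//].
  rewrite addr0 => /eqP; apply/negP.
  rewrite -(mlead_term _ wt1) mleadc_eq0 mulf_neq0 ?expf_neq0 //.
  by rewrite -msupp_eq0 msuppX.
rewrite (eq_bigr (fun t => term (t.1, t.2))) => [|[S e] _ //].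
rewrite -(pair_bigA _ (fun S e => term (S, e))) /= -big_split /=.
apply: eq_bigr => S _; rewrite big_bool /term /w /= setmon_gen /qnorm /gen_slot.
rewrite mulm1n mulm0n addm0 mpolyXD.
by move: 'X_[bexp S] 'X_last (z S).1 (z S).2 => B X x y; ring.
Qed.
End GenericPoint.

Section ClearDenominators.
Variable R : idomainType.

Lemma fraction_clear (x : {fraction R}) :
  exists2 d : R, d != 0 & exists y : R, x * tofrac d = tofrac y.
Proof.
elim/quotW: x => x; exists \d_x; [exact: denom_ratioP | exists \n_x].
unlock FracField.tofrac; rewrite -[LHS]FracField.pi_mul; apply/eqmodP.
rewrite /= FracField.equivfE /FracField.mulf /=.
by rewrite !numden_Ratio ?mulf_neq0 ?oner_eq0 ?denom_ratioP // !mulr1 mulrC.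
Qed.

Lemma fraction_clear_family (I : finType) (x : I -> {fraction R}) :
  exists2 d : R, d != 0 & exists y : I -> R, forall i, x i * tofrac d = tofrac (y i).
Proof.
have /boolp.choice[d dP] i : exists d : R, d != 0 /\ exists y : R,
    x i * tofrac d = tofrac y.
  by have [d d0 [y yE]] := fraction_clear (x i); exists d; split=> //; exists y.
have /boolp.choice[y yE] i : exists y : R, x i * tofrac (d i) = tofrac y.
  by have [] := dP i.
exists (\prod_i d i); first by apply/prodf_neq0 => i _; have [] := dP i.
exists (fun i => y i * \prod_(j | j != i) d j) => i.
by rewrite (bigD1 i) //= !tofracM mulrA yE.
Qed.

Lemma isotropic_tofrac n (a : R) (b : 'I_n -> R) :
  isotropic (tofrac a) (@tofrac R \o b) -> isotropic a b.
Proof.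
move=> [z z0 [S0 zS0]].
pose x (t : {set 'I_n} * bool) := if t.2 then (z t.1).2 else (z t.1).1.
have [d d0 [y yE]] := fraction_clear_family x.
have d0' : tofrac d != 0 by rewrite tofrac_eq0.
exists (fun S => (y (S, false), y (S, true))).
  apply/eqP; rewrite -tofrac_eq0 (pfister_morph (@tofrac R)).
  apply/eqP; rewrite -[RHS](mulr0 (tofrac d ^+ 2)) -z0 /pfister mulr_sumr.
  by apply: eq_bigr => S _; rewrite /qnorm /= -!yE /x /=; ring.
exists S0; move: zS0; rewrite !pair_neq0 /= -!(tofrac_eq0 (y _)) -!yE /x /=.
by rewrite !mulf_eq0 !(negPf d0') !orbF.
Qed.
End ClearDenominators.

(** * Finitely generated extensions *)

Section GeneratedField.
Variables (K F : fieldType) (s : {rmorphism K -> F}) (N : nat) (v : 'I_N -> F).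
Local Notation ev := (mmap s v).

(** Membership in the subfield K(v) of F, which [genField] turns into a field type. *)
Definition generated : {pred F} := fun x =>
  `[< exists P Q : {mpoly K[N]}, ev Q != 0 /\ x = ev P / ev Q >].

Lemma generatedP x : reflect
  (exists P Q : {mpoly K[N]}, ev Q != 0 /\ x = ev P / ev Q) (x \in generated).
Proof. exact: asboolP. Qed.

Lemma mmap_generated P : ev P \in generated.
Proof.
by apply/generatedP; exists P, 1; rewrite rmorph1 oner_eq0 divr1.
Qed.

Lemma generated_divring_closed : divring_closed generated.
Proof.
split=> [|x y /generatedP[P [Q [Q0 ->]]] /generatedP[P' [Q' [Q'0 ->]]]
         |x y /generatedP[P [Q [Q0 ->]]] /generatedP[P' [Q' [Q'0 ->]]]].
- by rewrite -(rmorph1 (mmap s v)) mmap_generated.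
- apply/generatedP; exists (P * Q' - P' * Q), (Q * Q').
  by rewrite rmorphB !rmorphM /= mulf_neq0 //; split=> //; field; apply/andP.
apply/generatedP; have [P'0|P'0] := eqVneq (ev P') 0.
  by exists 0, 1; rewrite P'0 mul0r invr0 mulr0 rmorph1 oner_eq0 mmap0 mul0r.
exists (P * Q'), (Q * P'); rewrite !rmorphM /= mulf_neq0 //; split=> //.
by rewrite invf_div mulrACA -invfM.
Qed.

HB.instance Definition _ :=
  GRing.isDivringClosed.Build F generated generated_divring_closed.

Record genField := GenField { genval :> F; _ : genval \in generated }.

HB.instance Definition _ := [isSub for genval].
HB.instance Definition _ := [Choice of genField by <:].
HB.instance Definition _ := [SubChoice_isSubIntegralDomain of genField by <:].
HB.instance Definition _ := [SubIntegralDomain_isSubField of genField by <:].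

Fact genval_zmod : zmod_morphism genval. Proof. by []. Qed.
Fact genval_monoid : monoid_morphism genval. Proof. by []. Qed.
HB.instance Definition _ :=
  GRing.isZmodMorphism.Build genField F genval genval_zmod.
HB.instance Definition _ :=
  GRing.isMonoidMorphism.Build genField F genval genval_monoid.

Lemma scalar_generated c : s c \in generated.
Proof. by rewrite -(mmapC v s) mmap_generated. Qed.

Definition genscalar c : genField := GenField (scalar_generated c).

Fact genscalar_zmod : zmod_morphism genscalar.
Proof. by move=> x y; apply: val_inj; rewrite /= rmorphB. Qed.
Fact genscalar_monoid : monoid_morphism genscalar.
Proof. by split=> [|x y]; apply: val_inj; rewrite /= ?rmorph1 ?rmorphM. Qed.
HB.instance Definition _ :=
  GRing.isZmodMorphism.Build K genField genscalar genscalar_zmod.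
HB.instance Definition _ :=
  GRing.isMonoidMorphism.Build K genField genscalar genscalar_monoid.

Lemma gen_generated i : v i \in generated.
Proof. by rewrite -(mmap1U v i) -(mmapX v s) mmap_generated. Qed.

Definition gengen i : genField := GenField (gen_generated i).

Lemma msize_prod_le (I : finType) (f : I -> {mpoly K[N]}) B :
  (forall i, msize (f i) <= B.+1)%N -> (msize (\prod_i f i) <= (#|I| * B).+1)%N.
Proof.
move=> fB; rewrite cardE -big_enum /=; elim: (enum I) => [|i r IH].
  by rewrite big_nil msize1.
rewrite big_cons /=.
have [->|f0] := eqVneq (f i) 0; first by rewrite mul0r mmeasure0.
have [->|r0] := eqVneq (\prod_(j <- r) f j) 0; first by rewrite mulr0 mmeasure0.
rewrite msizeM //; have := fB i; move: IH; clear; rewrite mulSn.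
by move: (msize (f i)) (msize (\prod_(j <- r) f j)) (size r * B)%N => x y t; lia.
Qed.

Lemma msize_exp_le (f : {mpoly K[N]}) B e :
  (msize f <= B.+1)%N -> (msize (f ^+ e) <= (e * B).+1)%N.
Proof.
move=> fB; rewrite -[e in f ^+ e]card_ord -prodr_const.
by rewrite -[e in (e * B)%N]card_ord; apply: msize_prod_le.
Qed.

(** The left side is at most C M^N with C = (d B + 1)^N, so M = C + 1 suffices because N < d. *)
Lemma box_count (d B : nat) : (N < d)%N ->
  exists M, (((d * (M * B)).+1 ^ N) < M ^ d)%N.
Proof.
move=> lt_Nd; pose C := ((d * B).+1 ^ N)%N; exists C.+1.
apply: (@leq_ltn_trans (((d * B).+1 * C.+1) ^ N)%N).
  suff le : ((d * (C.+1 * B)).+1 <= (d * B).+1 * C.+1)%N.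
    by case: (N) => // N'; rewrite leq_exp2r.
  rewrite [((d * B).+1 * _)%N]mulSn mulnCA [(C.+1 * (d * B))%N]mulnC.
  by rewrite -add1n leq_add2r.
rewrite expnMn -/C; apply: (@leq_trans (C.+1 ^ N.+1)%N).
  by rewrite expnS ltn_pmul2r // expn_gt0.
by rewrite leq_pexp2l.
Qed.

(* The M^d monomials in u of partial degrees < M have, after multiplication by a
   common denominator, degree O(M) in v, which leaves O(M^N) coefficients. *)
Lemma generated_dependent d (u : 'I_d -> F) : (N < d)%N ->
  (forall i, u i \in generated) ->
  exists2 p : {mpoly K[d]}, p != 0 & mmap s u p = 0.
Proof.
move=> lt_Nd u_gen.
have /boolp.choice[P /boolp.choice[Q PQ]] i : exists P Q : {mpoly K[N]},
    ev Q != 0 /\ u i = ev P / ev Q by apply/generatedP/u_gen.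
pose B := maxn (\max_i msize (P i)) (\max_i msize (Q i)).
have PB i : (msize (P i) <= B.+1)%N.
  by rewrite leqW // leq_max (leq_bigmax (F := fun i => msize (P i))).
have QB i : (msize (Q i) <= B.+1)%N.
  by rewrite leqW // leq_max (leq_bigmax (F := fun i => msize (Q i))) orbT.
have [M ltM] := box_count B lt_Nd.
(* [W e] evaluates to the monomial u^e times the common denominator, the M-th power of the product
   of the Q_i. *)
pose W (e : {ffun 'I_d -> 'I_M}) := \prod_i (P i ^+ e i * Q i ^+ (M - e i)).
have WB e : (msize (W e) <= (d * (M * B)).+1)%N.
  rewrite -[X in (X * _)%N]card_ord; apply: msize_prod_le => i.
  have [->|p0] := eqVneq (P i ^+ e i) 0; first by rewrite mul0r mmeasure0.
  have [->|q0] := eqVneq (Q i ^+ (M - e i)) 0; first by rewrite mulr0 mmeasure0.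
  have lep := msize_exp_le (e i) (PB i); have leq := msize_exp_le (M - e i) (QB i).
  rewrite msizeM //; move: lep leq; rewrite mulnBl.
  have : (e i * B <= M * B)%N by rewrite leq_mul2r ltnW ?orbT.
  move: (msize _) (msize _) (e i * B)%N (M * B)%N => x y z t; clear; lia.
have [|w [e0 we0] wW] := @rect_dependent K {ffun 'I_N -> 'I_(d * (M * B)).+1}
    {ffun 'I_d -> 'I_M} (fun e c => (W e)@_[multinom (c i : nat) | i < N]).
  by rewrite !card_ffun !card_ord.
have {}wW : \sum_e w e *: W e = 0.
  apply/mpolyP => m; rewrite raddf_sum mcoeff0 /=.
  have [lt_m|le_m] := ltnP (mdeg m) (d * (M * B)).+1.
    have m_lt i : (m i < (d * (M * B)).+1)%N.
      by apply: leq_ltn_trans lt_m; rewrite mdegE (bigD1 i) //= leq_addr.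
    rewrite -[RHS](wW [ffun i => Ordinal (m_lt i)]); apply: eq_bigr => e _.
    by rewrite mcoeffZ; congr (_ * _@__); apply/mnmP => i; rewrite mnmE ffunE.
  rewrite big1 // => e _; rewrite mcoeffZ [_@_m]memN_msupp_eq0 ?mulr0 //.
  by apply: msize_mdeg_ge; apply: leq_trans (WB e) le_m.
pose mon (e : {ffun 'I_d -> 'I_M}) : 'X_{1..d} := [multinom (e i : nat) | i < d].
have mon_inj : injective mon.
  move=> e e' /mnmP ee; apply/ffunP => i; apply: val_inj.
  by have := ee i; rewrite !mnmE.
exists (\sum_e w e *: 'X_[mon e]).
  apply: contra_neq we0 => /(congr1 (mcoeff (mon e0))).
  rewrite mcoeff0 raddf_sum (bigD1 e0) //= mcoeffZ mcoeffX eqxx mulr1.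
  rewrite big1 ?addr0 // => e ne.
  by rewrite mcoeffZ mcoeffX (inj_eq mon_inj) (negPf ne) mulr0.
have Qpi : \prod_i ev (Q i) ^+ M != 0.
  by apply/prodf_neq0 => i _; rewrite expf_neq0 //; have [] := PQ i.
apply: (mulIf Qpi); rewrite mul0r -[RHS](mmap0 v s) -wW !rmorph_sum mulr_suml.
apply: eq_bigr => e _ /=; rewrite !mmapZ mmapX -mulrA; congr (_ * _).
rewrite /mmap1 -big_split /= rmorph_prod; apply: eq_bigr => i _ /=.
have [Q0 ->] := PQ i; rewrite mnmE rmorphM !rmorphXn /=.
have -> : ev (Q i) ^+ M = ev (Q i) ^+ e i * ev (Q i) ^+ (M - e i).
  by rewrite -exprD subnKC // ltnW.
rewrite expr_div_n.
by rewrite mulrA mulfVK // expf_neq0.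
Qed.
End GeneratedField.

(** * Essential dimension *)

Lemma enat_le_trans x y z : enat_le x y -> enat_le y z -> enat_le x z.
Proof. by case: x y z => [x|] [y|] [z|] //=; apply: leq_trans. Qed.

Lemma enat_le_anti x y : enat_le x y -> enat_le y x -> x = y.
Proof.
by case: x y => [x|] [y|] //= le_xy le_yx; congr Some; apply/anti_leq/andP.
Qed.

Lemma einf_le (S : enat -> Prop) x : S x -> enat_le (einf S) x.
Proof. by move=> Sx; have [|_ h] := @einfP S; [exists x | apply: h]. Qed.

Section EssentialDimension.
Variables (k : closedFieldType) (n : nat).
Hypothesis k2 : 2%N \in [pchar k].

Lemma ed_elt_lca_le (F : extField k) (A : LCA k n F) :
  enat_le (ed_elt A) (Some n.+1).
Proof.
case: A => A lcaA; have [a [b [b0 AE]]] := lcaA.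
pose v (i : 'I_n.+1) : F := if unlift ord_max i is Some j then b j else a.
pose mor : {rmorphism k -> genField (ext_mor F) v} := genscalar (ext_mor F) v.
pose E := @ExtField k (genField (ext_mor F) v) mor.
pose j : extHom E F := @ExtHom k E F
  (@genval k F (ext_mor F) n.+1 v : {rmorphism E -> F}) (fun=> erefl).
pose gen i : E := gengen (ext_mor F) v i.
have lcaB : is_lca (fun l => iso_class (quat (gen ord_max) (gen (lift ord_max l)))).
  exists (gen ord_max), (fun l => gen (lift ord_max l)); split=> // l.
  by rewrite -(fmorph_eq0 j) /= /v liftK b0.
apply: (@enat_le_trans _ (trdeg E)).
  apply: einf_le; exists E, j, (exist _ _ lcaB); split=> //.
  apply: eq_exist; apply/funext => l /=.
  by rewrite class_ext_quat AE /= /v unlift_none liftK.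
have [_ lub] := esupP (fun x => exists d (u : 'I_d -> E), x = Some d /\ alg_indep u).
apply: lub => _ [d [u [-> indep]]] /=; rewrite leqNgt; apply/negP => lt_nd.
have [|p p0 pu] := @generated_dependent k F (ext_mor F) n.+1 v d
    (fun i => j (u i)) lt_nd; first by move=> i; case: (u i).
move/eqP: p0; apply; apply: indep; apply: (fmorph_inj j).
rewrite rmorph0 -pu /mmap rmorph_sum; apply: eq_bigr => m _ /=.
congr (_ * _); transitivity (j (\prod_i u i ^+ m i)) => //.
by rewrite rmorph_prod; apply: eq_bigr => i _; rewrite rmorphXn.
Qed.

(** Take a descent attaining the infimum. If its parameters [al], [be] were algebraically dependent,
    their form would be isotropic over E, hence over F, against the invariance of anisotropy. *)
Lemma ed_elt_lca_ge (F : extField k) (A : LCA k n F) (a : F) (b : 'I_n -> F) :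
    (0 < n)%N -> (forall l, b l != 0) ->
    (forall l, sval A l = iso_class (quat a (b l))) -> ~ isotropic a b ->
  enat_le (Some n.+1) (ed_elt A).
Proof.
move=> n_gt0 b0 AE anis.
have [|[E [j [[B lcaB] [BA edE]]]] _] := @einfP (fun x =>
    exists (E : extField k) (j : extHom E F) (B : LCA k n E),
    fmap (LCA k n) j B = A /\ x = trdeg E).
  exists (trdeg F), F, (ext_id F), A; split=> //; exact: fmap_id.
have {edE} -> : ed_elt A = trdeg E := edE.
have [al [be [be0 BE]]] := lcaB.
pose v (i : 'I_n.+1) : E := if unlift ord_max i is Some l then be l else al.
have [indep|dep] := pselect (alg_indep v).
  have [ub _] := esupP (fun x => exists d (u : 'I_d -> E), x = Some d /\ alg_indep u).
  by apply: ub; exists n.+1, v.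
have [p [pv p0]] : exists p, mmap (ext_mor E) v p = 0 /\ p != 0.
  apply: contrapT => no; apply: dep => p pv; apply/eqP/negPn/negP => p0.
  by apply: no; exists p.
have F2 : 2%N \in [pchar F] by exact: (rmorph_pchar (ext_mor F)).
have iso_E : isotropic al be.
  apply: (@tsen_isotropic k n E (ext_mor E) be al (muni p)) => //.
    by apply: contra_neq p0 => /muni_inj.
  rewrite -pv -mmap_muni {2}/v unlift_none; congr (map_poly (mmap _ _) _).[_].
  apply/funext => i; rewrite /v /= (_ : widen_ord _ i = lift ord_max i) ?liftK //.
  by apply: ord_inj; rewrite lift_max.
have iso_F : isotropic (j al) (j \o be).
  have [z z0 [S zS]] := iso_E.
  exists (fun S => (j (z S).1, j (z S).2)).
    by rewrite -pfister_morph z0 rmorph0.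
  by exists S; move: zS; rewrite !pair_neq0 /= !fmorph_eq0.
case: (@anisotropic_quat_iso F F2 n n_gt0 (j al) a (j \o be) b) => // [l|l].
  by rewrite /= fmorph_eq0.
(* Evaluating the equality of classes at [quat a (b l)] yields an actual algebra isomorphism. *)
have := AE l; rewrite -BA /= BE class_ext_quat.
move=> /(congr1 (fun c : alg_class F => c (quat a (b l)))) e.
have : iso_class (quat a (b l)) (quat a (b l)).
  by exists (idfun : {lrmorphism quat a (b l) -> quat a (b l)}); exists idfun.
by rewrite -e.
Qed.

Lemma generic_lca : exists (F : extField k) (a : F) (b : 'I_n -> F),
  (forall l, b l != 0) /\ ~ isotropic a b.
Proof.
pose R := {mpoly k[n.+1]}.
pose F := @ExtField k {fraction R}
  (@tofrac R \o @mpolyC n.+1 k : {rmorphism k -> {fraction R}}).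
exists F, (tofrac (gen_slot k n)), (@tofrac R \o @gen_slots k n).
split=> [l|/isotropic_tofrac]; last exact: generic_anisotropic.
by rewrite /= tofrac_eq0 /gen_slots -msupp_eq0 msuppX.
Qed.

Definition lca_of (F : extField k) (a : F) (b : 'I_n -> F)
    (b0 : forall l, b l != 0) : LCA k n F :=
  exist _ (fun l => iso_class (quat a (b l)))
    (ex_intro _ a (ex_intro _ b (conj b0 (fun=> erefl)))).

Lemma dim_regular (K : fieldType) : \dim {: K^o} = 1%N.
Proof. by rewrite dimvf. Qed.

Lemma edp_elt_lca_le (F : extField k) (A : LCA k n F) :
  enat_le (edp_elt 2 A) (Some n.+1).
Proof.
apply: (@enat_le_trans _ (ed_elt (fmap (LCA k n) (finExt_hom F^o) A))).
  by apply: einf_le; exists F^o; rewrite dim_regular coprime1n.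
exact: ed_elt_lca_le.
Qed.

(** Springer's theorem keeps the form anisotropic over every odd-degree L, where the bound for
    [ed_elt] applies. *)
Lemma edp_elt_lca_ge (F : extField k) (a : F) (b : 'I_n -> F)
    (b0 : forall l, b l != 0) :
  (0 < n)%N -> ~ isotropic a b -> enat_le (Some n.+1) (edp_elt 2 (lca_of a b0)).
Proof.
move=> n_gt0 anis; have F2 : 2%N \in [pchar F] by exact: (rmorph_pchar (ext_mor F)).
have [|[L [odd_L edL]] _] := @einfP (fun x => exists L : fieldExtType F,
    coprime (\dim {:L}) 2 /\ x = ed_elt (fmap (LCA k n) (finExt_hom L) (lca_of a b0))).
  by eexists; exists F^o; split; first by rewrite dim_regular coprime1n.
rewrite [edp_elt _ _]edL.
apply: (@ed_elt_lca_ge (finExt L) _ (in_alg L a) (in_alg L \o b)) => //.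
- by move=> l; have := b0 l; rewrite -(fmorph_eq0 (GRing.in_alg L)).
- by move=> l; rewrite /= class_ext_quat.
exact: springer.
Qed.
End EssentialDimension.

Theorem proposition5p3 (k : closedFieldType) (k2 : 2%N \in [pchar k])
    (n : nat) (n_gt0 : (0 < n)%N) :
  ed (LCA k n) = Some n.+1 /\ edp 2 (LCA k n) = Some n.+1.
Proof.
have [F [a [b [b0 anis]]]] := generic_lca k n.
split; apply: enat_le_anti.
- have [_ lub] := esupP (fun x => exists (F : extField k) (A : LCA k n F),
    x = ed_elt A).
  by apply: lub => _ [F' [A ->]]; apply: ed_elt_lca_le.
- apply: (@enat_le_trans _ (ed_elt (lca_of a b0))).
    exact: (@ed_elt_lca_ge k n k2 F (lca_of a b0) a b n_gt0 b0 (fun=> erefl) anis).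
  have [ub _] := esupP (fun x => exists (F : extField k) (A : LCA k n F),
    x = ed_elt A).
  by apply: ub; exists F, (lca_of a b0).
- have [_ lub] := esupP (fun x => exists (F : extField k) (A : LCA k n F),
    x = edp_elt 2 A).
  by apply: lub => _ [F' [A ->]]; apply: edp_elt_lca_le.
apply: (@enat_le_trans _ (edp_elt 2 (lca_of a b0))); first exact: edp_elt_lca_ge.
have [ub _] := esupP (fun x => exists (F : extField k) (A : LCA k n F),
    x = edp_elt 2 A).
by apply: ub; exists F, (lca_of a b0).
Qed.
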